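(* (Uniqueness.) Assume that there exists a constant $\Lambda>0$ such that $$\big|\mu(|\mathbf{T}|)\mathbf{T}-\mu(|\mathbf{S}|)\mathbf{S}\big|\le\Lambda|\mathbf{T}-\mathbf{S}|\qquad\forall\,\mathbf{T},\mathbf{S}\in\mathbb{R}^{d\times d}_{\mathrm{sym},0}.$$ If $$\frac{\gamma}{\alpha}\Lambda+\alpha^2C_S^2C_PC_K^4\|\mathbf{f}\|_{L^2(\Omega)}+\alpha\gamma C_S^2C_K^3C_1|\Omega|^{1/2}<1,$$ then the solution $(\mathbf{T},\mathbf{u})\in M\times\mathcal{V}$ of the problem: for all $(\mathbf{S},\mathbf{v})\in M\times\mathcal{V}$, $$\int_\Omega[(\mathbf{u}\cdot\nabla)\mathbf{u}]\cdot\mathbf{v}+\frac1\alpha\int_\Omega\mathbf{D}(\mathbf{u}):\mathbf{D}(\mathbf{v})=\int_\Omega\mathbf{f}\cdot\mathbf{v}+\frac\gamma\alpha\int_\Omega\mu(|\mathbf{T}|)\mathbf{T}:\mathbf{D}(\mathbf{v}),$$ $$\alpha\int_\Omega\mathbf{T}:\mathbf{S}+\gamma\int_\Omega\mu(|\mathbf{T}|)\mathbf{T}:\mathbf{S}=\int_\Omega\mathbf{D}(\mathbf{u}):\mathbf{S},$$ is unique.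
   Context: Let $d\in\{2,3\}$, let $\Omega\subset\mathbb{R}^d$ be a bounded, open, simply connected Lipschitz domain, $\mathbf{f}\in L^2(\Omega)^d$, and let $\alpha,\gamma>0$ be constants. Let $\mu\in C^1((0,\infty))\cap C^0([0,\infty))$ be real-valued with $\frac{d}{da}(\mu(a)a)>0$ for all $a>0$, and $\mu(a)>0$, $\mu(a)a\le C_1$ for all $a\ge0$, where $C_1>0$ is a constant. Notation: $\mathbf{D}(\mathbf{v})=\frac12(\nabla\mathbf{v}+(\nabla\mathbf{v})^t)$; $|\mathbf{S}|=\sqrt{\mathbf{S}:\mathbf{S}}$ is the Frobenius norm; $\mathbb{R}^{d\times d}_{\mathrm{sym},0}$ is the space of symmetric $d\times d$ real matrices with zero trace; $V=H_0^1(\Omega)^d$; $\mathcal{V}=\{\mathbf{v}\in V:\operatorname{div}\mathbf{v}=0\}$; $M=\{\mathbf{S}\in L^2(\Omega)^{d\times d}:\mathbf{S}\text{ symmetric},\ \operatorname{tr}\mathbf{S}=0\}$. Norms of vector (tensor) fields are norms of the pointwise Euclidean (Frobenius) norm. $C_P,C_K>0$ are constants with $\|v\|_{L^2(\Omega)}\le C_P\|\nabla v\|_{L^2(\Omega)}$ for all $v\in H_0^1(\Omega)$ (Poincaré) and $\|\nabla\mathbf{v}\|_{L^2(\Omega)}\le C_K\|\mathbf{D}(\mathbf{v})\|_{L^2(\Omega)}$ for all $\mathbf{v}\in V$ (Korn). $C_S$ is the smallest positive constant with $\|\mathbf{v}\|_{L^4(\Omega)}\le C_S\|\nabla\mathbf{v}\|_{L^2(\Omega)}$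 for all $\mathbf{v}\in V$. *)

(* Defs.v *)
From HB Require Import structures.
From mathcomp Require Import all_boot all_order all_algebra.
From mathcomp Require Import all_classical all_reals all_analysis.

Set Implicit Arguments.
Unset Strict Implicit.
Unset Printing Implicit Defensive.

Import Order.TTheory GRing.Theory Num.Theory.
Import numFieldNormedType.Exports.

Local Open Scope classical_set_scope.
Local Open Scope ring_scope.

Section borel_rV.
Context {R : realType} {n : nat}.

(* Borel sigma-algebra of R^n *)
Definition borel_rV : set (set 'rV[R]_n) := <<s @open 'rV[R]_n >>.

Let borel_rV_bigcup (F : (set 'rV[R]_n)^nat) :
  (forall i, borel_rV (F i)) -> borel_rV (\bigcup_i (F i)).
Proof. exact: sigma_algebra_bigcup. Qed.

HB.instance Definition _ := @isMeasurable.Build default_measure_display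
  'rV[R]_n borel_rV (@sigma_algebra0 _ setT open) (@sigma_algebraC _ open)
  borel_rV_bigcup.

Lemma open_measurable_rV (U : set 'rV[R]_n) : open U -> measurable U.
Proof. by move=> oU; exact: sub_sigma_algebra. Qed.

Lemma open_rV_bigcup_rat (U : set 'rV[R]_n) : open U ->
  U = \bigcup_(p in [set p : 'rV[rat]_n * rat |
         ball (map_mx ratr p.1 : 'rV[R]_n) (ratr p.2) `<=` U])
      ball (map_mx ratr p.1 : 'rV[R]_n) (ratr p.2).
Proof.
move=> oU; apply/seteqP; split=> [x Ux|x [p /= pU xp]]; last exact: pU.
have : nbhs x U by rewrite nbhsE /=; exists U.
rewrite -nbhs_ballE => -[e /= e0 xeU].
have /rat_in_itvoo[r] : 0 < e / 2 by rewrite divr_gt0.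
rewrite in_itv /= => /andP[r0 re].
have /choice[f fP] (j : 'I_n) : exists q : rat, `|x ord0 j - ratr q| < ratr r.
  have /rat_in_itvoo[q] : x ord0 j - ratr r < x ord0 j + ratr r.
    by rewrite ltrD2l gt0_cp.
  rewrite in_itv /= => /andP[q1 q2]; exists q.
  by rewrite ltr_distlC q1 q2.
pose q : 'rV[rat]_n := \row_j f j.
have xq : ball (map_mx ratr q : 'rV[R]_n) (ratr r) x.
  by split=> // i j; rewrite !mxE ord1 /ball /= distrC.
exists (q, r) => //= y qy; apply: xeU.
rewrite (splitr e); apply: ball_triangle (le_ball (ltW re) qy).
exact/(le_ball (ltW re))/ball_sym.
Qed.

Lemma measurable_fun_rVP d (T : measurableType d) (f : T -> 'rV[R]_n) :
  (forall j, measurable_fun setT (fun t => f t ord0 j)) ->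
  measurable_fun setT f.
Proof.
move=> mf; apply: (@measurability _ _ _ _ setT f open) => //.
move=> _ [U oU <-]; rewrite setTI (open_rV_bigcup_rat oU) preimage_bigcup.
rewrite bigcup_mkcond; apply: countable_bigcupT_measurable => // -[q r].
case: ifPn => // _.
have [r0|r0] := ltP 0 (ratr r : R); last first.
  rewrite (_ : _ @^-1` _ = set0) //; apply/seteqP; split=> // t [].
  by rewrite ltNge r0.
rewrite (_ : _ @^-1` _ =
  \bigcap_(j in [set: 'I_n]) ((fun t => f t ord0 j) @^-1`
     ball (ratr (q ord0 j) : R) (ratr r))).
  apply: fin_bigcap_measurable => // j _.
  rewrite -[X in measurable X]setTI; apply: mf => //.
  by rewrite ball_itv; exact: measurable_itv.
apply/seteqP; split=> t /=.
  by move=> [_ H] j _; have := H ord0 j; rewrite mxE.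
by move=> H; split=> // i j; rewrite mxE ord1; exact: H.
Qed.

Lemma continuous_measurable_fun_rV (f : 'rV[R]_n -> R) :
  continuous f -> measurable_fun setT f.
Proof.
move=> /continuousP cf; apply: (measurability _ (measurable_realfun.RGenOpens.measurableE R)).
move=> _ [_ [a [b ->] <-]]; rewrite setTI; apply: open_measurable_rV.
exact/cf/interval_open.
Qed.

End borel_rV.

Section lebesgue_rV.
Context {R : realType}.
Local Open Scope ereal_scope.

Definition cons_rV n (p : measurableTypeR R * 'rV[R]_n) : 'rV[R]_n.+1 :=
  row_mx (p.1%:M : 'rV[R]_1) p.2.

Lemma measurable_cons_rV n : measurable_fun setT (@cons_rV n).
Proof.
apply: measurable_fun_rVP => j.
have -> : (fun p => @cons_rV n p ord0 j) =
    (fun p => match fintype.split (j : 'I_(1 + n)) with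
              | inl _ => p.1 | inr k => p.2 ord0 k end).
  apply/funext => p; rewrite /cons_rV mxE; case: fintype.split => // k.
  by rewrite mxE (ord1 k) eqxx.
case: fintype.split => k; first exact: measurable_fst.
have mk : measurable_fun setT (fun v : 'rV[R]_n => v ord0 k).
  by apply: continuous_measurable_fun_rV => x; exact: coord_continuous.
exact: (measurableT_comp mk measurable_snd).
Qed.

Definition uncons_rV n (x : 'rV[R]_n.+1) : measurableTypeR R * 'rV[R]_n :=
  (x ord0 ord0, @rsubmx _ 1 1 n x).

Lemma cons_rVK n : cancel (@cons_rV n) (@uncons_rV n).
Proof.
case=> a v; congr (_, _); last exact: row_mxKr.
rewrite /cons_rV mxE; case: fintype.splitP => // j _.
by rewrite mxE (ord1 j) eqxx.
Qed.

Lemma measurable_uncons_rV n : measurable_fun setT (@uncons_rV n).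
Proof.
apply/measurable_fun_pairP; split.
  by apply: continuous_measurable_fun_rV => x; exact: coord_continuous.
apply: measurable_fun_rVP => j.
under eq_fun do rewrite /= mxE.
by apply: continuous_measurable_fun_rV => x; exact: coord_continuous.
Qed.

Section step.
Variables (n : nat) (mu : {sigma_finite_measure set 'rV[R]_n -> \bar R}).

Definition lebesgue_rV_step : set 'rV[R]_n.+1 -> \bar R :=
  pushforward (lebesgue_measure \x mu) (@cons_rV n).

HB.instance Definition _ := Measure.copy lebesgue_rV_step
  (measure_function_pushforward__canonical__measure_function_Measure
     (lebesgue_measure \x mu)%E (@measurable_cons_rV n)).

Let lebesgue_rV_step_sigma_finite : sigma_finite setT lebesgue_rV_step.
Proof.
have /sigma_finiteP[F [FT ndF Foo]] :
  sigma_finite setT (@lebesgue_measure R) by exact: sigma_finiteT.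
have /sigma_finiteP[G [GT ndG Goo]] := sigma_finiteT mu.
exists (fun k => @uncons_rV n @^-1` (F k `*` G k)).
  rewrite -preimage_bigcup -[LHS](preimage_setT (@uncons_rV n)).
  congr (_ @^-1` _); apply/seteqP; split=> // -[x y] _.
  have [k _ Fkx] : (\bigcup_i F i) x by rewrite -FT.
  have [l _ Gly] : (\bigcup_i G i) y by rewrite -GT.
  exists (maxn k l) => //; split=> /=.
    by move: x Fkx; exact/subsetPset/ndF/leq_maxl.
  by move: y Gly; exact/subsetPset/ndG/leq_maxr.
move=> k; have [mF Fk] := Foo k; have [mG Gk] := Goo k; split.
  rewrite -[X in measurable X]setTI; apply: measurable_uncons_rV => //.
  exact: measurableX.
rewrite /lebesgue_rV_step /pushforward -comp_preimage.
rewrite (_ : _ \o _ = id); last by apply/funext => p; exact: cons_rVK.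
rewrite preimage_id product_measure1E// lte_mul_pinfty// ge0_fin_numE//.
Qed.

HB.instance Definition _ := Measure_isSigmaFinite.Build _ _ _
  lebesgue_rV_step lebesgue_rV_step_sigma_finite.

End step.

(* Lebesgue measure on the Borel sets of R^n, as an iterated product measure *)
Fixpoint lebesgue_rV n : {sigma_finite_measure set 'rV[R]_n -> \bar R} :=
  match n with
  | 0%N => \d_(0%R : 'rV[R]_0)
  | m.+1 => lebesgue_rV_step (lebesgue_rV m)
  end.

End lebesgue_rV.

Section tensors.
Context {R : realType} {m n : nat}.
Implicit Types A B : 'M[R]_(m, n).

(* The contraction A : B; on row vectors it is the scalar product. *)
Definition mxdot A B : R := \sum_i \sum_j A i j * B i j.

Definition frob A : R := Num.sqrt (mxdot A A).

End tensors.

Section domains.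
Context {R : realType}.

Definition simply_connected n (A : set 'rV[R]_n) : Prop :=
  [/\ A !=set0,
      (forall x y, A x -> A y -> exists c : R -> 'rV[R]_n,
        [/\ {within `[0, 1], continuous c}, c @` `[0, 1] `<=` A,
            c 0 = x & c 1 = y]) &
      (forall c : R -> 'rV[R]_n,
        {within `[0, 1], continuous c} -> c @` `[0, 1] `<=` A -> c 0 = c 1 ->
        exists H : R * R -> 'rV[R]_n,
        [/\ {within `[0, 1] `*` `[0, 1], continuous H},
            H @` (`[0, 1] `*` `[0, 1]) `<=` A,
            {in `[0, 1], forall t, H (0, t) = c t},
            {in `[0, 1], forall t, H (1, t) = c 0} &
            {in `[0, 1], forall s, H (s, 0) = c 0 /\ H (s, 1) = c 0}])].

(* Near each boundary point, after an orthogonal change of coordinates Q, the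
   set A is the strict epigraph of a Lipschitz function h of the coordinates
   other than the k-th one. *)
Definition lipschitz_boundary n (A : set 'rV[R]_n) : Prop :=
  forall x0, (closure A `\` interior A) x0 ->
  exists (Q : 'M[R]_n) (k : 'I_n) (h : 'rV[R]_n.-1 -> R),
  [/\ Q *m Q^T = 1%:M, lipschitz h &
      \forall x \near x0, A x <-> h (col' k (x *m Q)) < (x *m Q) 0 k].

End domains.

Section sobolev.
Context {R : realType} {d : nat}.
Variable Omega : set 'rV[R]_d.

Local Notation leb := (lebesgue_rV d).

Definition partial (j : 'I_d) (phi : 'rV[R]_d -> R) : 'rV[R]_d -> R :=
  fun x => 'D_'e_j phi x.

Definition grad (phi : 'rV[R]_d -> R) (x : 'rV[R]_d) : 'rV[R]_d :=
  \row_j partial j phi x.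

Definition smooth (phi : 'rV[R]_d -> R) : Prop :=
  forall s : seq 'I_d, let psi := foldr partial phi s in
  continuous psi /\ forall j x, derivable psi x 'e_j.

(* C_c^oo(Omega), the functions being extended by 0 to R^d *)
Definition test_function (phi : 'rV[R]_d -> R) : Prop :=
  [/\ smooth phi, compact (closure [set x | phi x != 0]) &
      closure [set x | phi x != 0] `<=` Omega].

(* Norm of L^p(Omega); for a field v it is applied to frob \o v. *)
Definition LpNorm (p : R) (f : 'rV[R]_d -> R) : \bar R :=
  'N[leb]_p%:E [EFin \o f \_ Omega].

Definition L2 (f : 'rV[R]_d -> R) : Prop := f \_ Omega \in Lfun leb 2%:E.

Definition L2field m n (v : 'rV[R]_d -> 'M[R]_(m, n)) : Prop :=
  forall i j, L2 (fun x => v x i j).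

Definition weak_gradient (u : 'rV[R]_d -> R) (g : 'rV[R]_d -> 'rV[R]_d) : Prop :=
  forall phi, test_function phi -> forall j,
    \int[leb]_(x in Omega) (u x * partial j phi x) =
    - \int[leb]_(x in Omega) (g x 0 j * phi x).

(* Functions are representatives of their almost-everywhere classes, and an
   element of H^1_0 comes with (a representative of) its weak gradient g:
   u is an H^1-limit of test functions. *)
Definition H10 (u : 'rV[R]_d -> R) (g : 'rV[R]_d -> 'rV[R]_d) : Prop :=
  [/\ L2 u, L2field g, weak_gradient u g &
      forall e : R, 0 < e -> exists phi, [/\ test_function phi,
        (LpNorm 2 (fun x => u x - phi x)%R < e%:E)%E &
        (LpNorm 2 (fun x => frob (g x - grad phi x))%R < e%:E)%E]].

(* V = H^1_0(Omega)^d; G x i j is the j-th partial derivative of v_i. *)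
Definition spaceV (v : 'rV[R]_d -> 'rV[R]_d) (G : 'rV[R]_d -> 'M[R]_d) : Prop :=
  forall i, H10 (fun x => v x 0 i) (fun x => row i (G x)).

(* The divergence of v is the trace of its gradient. *)
Definition spaceVdiv (v : 'rV[R]_d -> 'rV[R]_d) (G : 'rV[R]_d -> 'M[R]_d) : Prop :=
  spaceV v G /\ {ae leb, forall x, Omega x -> \tr (G x) = 0}.

Definition spaceM (S : 'rV[R]_d -> 'M[R]_d) : Prop :=
  L2field S /\ {ae leb, forall x, Omega x -> (S x)^T = S x /\ \tr (S x) = 0}.

(* The symmetric part; D(v) is symgrad \o G for G the gradient of v. *)
Definition symgrad (G : 'M[R]_d) : 'M[R]_d := 2^-1 *: (G + G^T).

(* ((u . nabla) u)_i = \sum_j u_j d_j u_i *)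
Definition convection (u : 'rV[R]_d) (G : 'M[R]_d) : 'rV[R]_d := u *m G^T.

Definition Poincare_const (C : R) : Prop :=
  0 < C /\ forall u g, H10 u g ->
    (LpNorm 2 u <= C%:E * LpNorm 2 (frob \o g))%E.

Definition Korn_const (C : R) : Prop :=
  0 < C /\ forall v G, spaceV v G ->
    (LpNorm 2 (frob \o G) <= C%:E * LpNorm 2 (frob \o (symgrad \o G)))%E.

Definition Sobolev_const (C : R) : Prop :=
  0 < C /\ forall v G, spaceV v G ->
    (LpNorm 4 (frob \o v) <= C%:E * LpNorm 2 (frob \o G))%E.

Definition is_solution (alpha gamma : R) (mu : R -> R)
    (f : 'rV[R]_d -> 'rV[R]_d)
    (T : 'rV[R]_d -> 'M[R]_d) (u : 'rV[R]_d -> 'rV[R]_d) : Prop :=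
  spaceM T /\ exists2 Gu, spaceVdiv u Gu &
  forall S v Gv, spaceM S -> spaceVdiv v Gv ->
    \int[leb]_(x in Omega) mxdot (convection (u x) (Gu x)) (v x)
      + alpha^-1 *
        \int[leb]_(x in Omega) mxdot (symgrad (Gu x)) (symgrad (Gv x))
    = \int[leb]_(x in Omega) mxdot (f x) (v x)
      + gamma / alpha *
        \int[leb]_(x in Omega) mxdot (mu (frob (T x)) *: T x) (symgrad (Gv x))
    /\
    alpha * \int[leb]_(x in Omega) mxdot (T x) (S x)
      + gamma * \int[leb]_(x in Omega) mxdot (mu (frob (T x)) *: T x) (S x)
    = \int[leb]_(x in Omega) mxdot (symgrad (Gu x)) (S x).

End sobolev.

(* Main.v *)
Require Import Defs.
From HB Require Import structures.
From mathcomp Require Import all_boot all_order all_algebra.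
From mathcomp Require Import all_classical all_reals all_analysis.
From mathcomp Require Import measurable_realfun.
From mathcomp Require Import ring lra.

Import Order.TTheory GRing.Theory Num.Theory.
Import numFieldNormedType.Exports.

(** The proof is an energy estimate for the difference of two solutions.
    Write w = u1 - u2, E = T1 - T2 and N = mu(|T1|) T1 - mu(|T2|) T2.

    The constitutive law for the difference, tested with E, reads
    alpha |E|^2 + gamma (N, E) = (D(w), E).  Since a |-> mu(a) a increases, the
    map T |-> mu(|T|) T is monotone ([flux_monotone]), so (N, E) >= 0 and
    alpha |E| <= |D(w)|.

    The momentum balance for the difference is tested with w.  The convection
    form of a solenoidal field is skew symmetric ([convection_eq0]), so that
    among the convection terms only the integral of ((w . grad) u1) . w is left
    ([convection_diff]); by the Sobolev and Korn inequalities it is at most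
    CS^2 CK^3 |D(w)|^2 |D(u1)|.  The same skew symmetry removes the convection
    term when the equation for u1 is tested with u1, and gives the a priori
    bound |D(u1)| <= alpha CP CK |f| + gamma C1 |Omega|^(1/2)
    ([strain_apriori_le], [normL2_bounded]).  With the Lipschitz bound
    |N| <= Lambda |E| these estimates combine into
    |D(w)|^2 <= theta |D(w)|^2, where theta is the quantity assumed to be less
    than 1 ([energy_contraction]).  Hence D(w) = 0, then E = 0, and w = 0 by the
    inequalities of Korn and Poincare.

    Skew symmetry is proved by density of the test functions in H^1_0.  For a
    smooth compactly supported field Phi it holds because Phi_i d_j Phi_i is half
    the derivative of the test function Phi_i^2, which the weak gradient of
    u turns into the divergence of u ([convection_test_eq0]).  It passes
    to the limit Phi -> w in H^1 because the convection form is bounded there.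
    This bound applies the Sobolev inequality to w - Phi, so it has to be known that
    test functions belong to H^1_0, that is, that their classical gradients are weak gradients.  This is
    integration by parts on R^n, obtained from Fubini's theorem and the
    fundamental theorem of calculus ([integral_partial_eq0]).

    All the integrals are handled as scalar products of square integrable
    tensor fields.  In particular the integral of ((u . grad) w) . v is the
    scalar product of grad w with the tensor v (x) u, whose norm is controlled
    by the L4 norms of v and u ([normL2_outer]). *)

Set Implicit Arguments.
Unset Strict Implicit.

Local Open Scope classical_set_scope.
Local Open Scope ring_scope.

(** * Contraction of tensors and square integrable tensor fields *)

(** Gives Cauchy-Schwarz both for tensors and for tensor fields. *)
Lemma discriminant_le (R : realFieldType) (a b c : R) : 0 <= a -> 0 <= c ->
  (forall t, 0 <= a + 2 * t * b + t ^+ 2 * c) -> b ^+ 2 <= a * c.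
Proof.
move=> a0; rewrite le_eqVlt => /predU1P[<- H|c0 H].
  have [->|b0] := eqVneq b 0; first by rewrite expr0n /= mulr0.
  have := H (- (a + 1) / (2 * b)).
  rewrite (_ : a + _ + _ = -1) ?ler0N1 //.
  by field.
have := H (- b / c).
rewrite (_ : a + _ + _ = (a * c - b ^+ 2) / c); last by field; rewrite gt_eqF.
by rewrite pmulr_lge0 ?invr_gt0 // subr_ge0.
Qed.

Section mxdot_theory.
Context {R : realType} {m n : nat}.
Implicit Types A B C : 'M[R]_(m, n).

Lemma mxdotC A B : mxdot A B = mxdot B A.
Proof. by apply: eq_bigr => i _; apply: eq_bigr => j _; rewrite mulrC. Qed.

Lemma mxdotDl A B C : mxdot (A + B) C = mxdot A C + mxdot B C.
Proof.
rewrite /mxdot -big_split; apply: eq_bigr => i _; rewrite -big_split.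
by apply: eq_bigr => j _; rewrite mxE mulrDl.
Qed.

Lemma mxdotZl (a : R) A C : mxdot (a *: A) C = a * mxdot A C.
Proof.
rewrite /mxdot mulr_sumr; apply: eq_bigr => i _; rewrite mulr_sumr.
by apply: eq_bigr => j _; rewrite mxE mulrA.
Qed.

Lemma mxdotDr A B C : mxdot C (A + B) = mxdot C A + mxdot C B.
Proof. by rewrite mxdotC mxdotDl !(mxdotC C). Qed.

Lemma mxdotZr (a : R) A C : mxdot C (a *: A) = a * mxdot C A.
Proof. by rewrite mxdotC mxdotZl (mxdotC C). Qed.

Lemma mxdotBl A B C : mxdot (A - B) C = mxdot A C - mxdot B C.
Proof. by rewrite mxdotDl -scaleN1r mxdotZl mulN1r. Qed.

Lemma mxdotBr A B C : mxdot C (A - B) = mxdot C A - mxdot C B.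
Proof. by rewrite mxdotC mxdotBl !(mxdotC C). Qed.

Lemma mxdot0l A : mxdot 0 A = 0.
Proof. by rewrite -(scale0r A) mxdotZl mul0r. Qed.

Lemma mxdot_ge0 A : 0 <= mxdot A A.
Proof.
by apply: sumr_ge0 => i _; apply: sumr_ge0 => j _; rewrite -expr2 sqr_ge0.
Qed.

Lemma mxdot_eq0 A : mxdot A A = 0 -> A = 0.
Proof.
move/eqP; rewrite psumr_eq0 => [/allP H|i _]; last first.
  by apply: sumr_ge0 => j _; rewrite -expr2 sqr_ge0.
apply/matrixP => i j; rewrite mxE.
have := H i (mem_index_enum _); rewrite psumr_eq0 => [/allP|k _]; last first.
  by rewrite -expr2 sqr_ge0.
by move=> /(_ j (mem_index_enum _)); rewrite mulf_eq0 orbb => /eqP.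
Qed.

Lemma sqr_frob A : frob A ^+ 2 = mxdot A A.
Proof. by rewrite sqr_sqrtr // mxdot_ge0. Qed.

Lemma frob_ge0 A : 0 <= frob A.
Proof. exact: sqrtr_ge0. Qed.

Lemma mxdot_le_frob A B : `|mxdot A B| <= frob A * frob B.
Proof.
rewrite -ler_sqr ?nnegrE ?mulr_ge0 ?frob_ge0 // exprMn !sqr_frob.
rewrite real_normK ?num_real //.
apply: discriminant_le => [||t]; rewrite ?mxdot_ge0 //.
suff <- : mxdot (A + t *: B) (A + t *: B) =
    mxdot A A + 2 * t * mxdot A B + t ^+ 2 * mxdot B B by exact: mxdot_ge0.
by rewrite !mxdotDl !mxdotDr !mxdotZl !mxdotZr (mxdotC B A); ring.
Qed.

Lemma entry_le_frob A i j : `|A i j| <= frob A.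
Proof.
rewrite -ler_sqr ?nnegrE ?frob_ge0 // sqr_frob real_normK ?num_real //.
rewrite /mxdot (bigD1 i) //= (bigD1 j) //= -expr2 -addrA lerDl addr_ge0 //.
  by apply: sumr_ge0 => k _; rewrite -expr2 sqr_ge0.
by apply: sumr_ge0 => k _; apply: sumr_ge0 => l _; rewrite -expr2 sqr_ge0.
Qed.

Lemma frobZ (a : R) A : 0 <= a -> frob (a *: A) = a * frob A.
Proof.
move=> a0; rewrite /frob mxdotZl mxdotZr mulrA -expr2 sqrtrM ?sqr_ge0 //.
by rewrite sqrtr_sqr ger0_norm.
Qed.

End mxdot_theory.

Lemma mxdot_outer (R : realType) m n (v v' : 'rV[R]_m) (u u' : 'rV[R]_n) :
  mxdot (v^T *m u) (v'^T *m u') = mxdot v v' * mxdot u u'.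
Proof.
rewrite /mxdot !big_ord1 mulr_suml; apply: eq_bigr => i _.
rewrite mulr_sumr; apply: eq_bigr => j _.
by rewrite !mxE !big_ord1 !mxE; ring.
Qed.

(** Rewrites convection terms as scalar products of a gradient, known to be in
    L2, with a tensor built from two velocities, known to be in L4. *)
Lemma mxdot_convection (R : realType) n (u v : 'rV[R]_n) (G : 'M[R]_n) :
  mxdot (convection u G) v = mxdot G (v^T *m u).
Proof.
rewrite /mxdot /convection big_ord1; apply: eq_bigr => i _.
rewrite mxE mulr_suml; apply: eq_bigr => j _.
by rewrite !mxE big_ord1 !mxE; ring.
Qed.

Section square_integrable.
Context d (X : measurableType d) (R : realType).
Variables (mu : {measure set X -> \bar R}) (D : set X).
Hypothesis mD : measurable D.

Lemma integrable_addr (f g : X -> R) : mu.-integrable D (EFin \o f) ->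
  mu.-integrable D (EFin \o g) ->
  mu.-integrable D (EFin \o (fun x => f x + g x)).
Proof. by move=> If Ig; have := integrableD mD If Ig; apply: eq_integrable. Qed.

Lemma integrable_subr (f g : X -> R) : mu.-integrable D (EFin \o f) ->
  mu.-integrable D (EFin \o g) ->
  mu.-integrable D (EFin \o (fun x => f x - g x)).
Proof. by move=> If Ig; have := integrableB mD If Ig; apply: eq_integrable. Qed.

Lemma integrable_mulr (a : R) (f : X -> R) : mu.-integrable D (EFin \o f) ->
  mu.-integrable D (EFin \o (fun x => a * f x)).
Proof. by move=> If; have := integrableZl mD a If; apply: eq_integrable. Qed.

Definition sqint (f : X -> R) :=
  measurable_fun D f /\ mu.-integrable D (EFin \o (fun x => f x ^+ 2)).

Lemma sqint_le (f g : X -> R) : measurable_fun D f ->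
  (forall x, D x -> `|f x| <= `|g x|) -> sqint g -> sqint f.
Proof.
move=> mf fg [mg ig]; split => //.
apply: le_integrable ig => //.
  by apply/measurable_EFinP; exact: measurable_funX.
by move=> x Dx /=; rewrite lee_fin !normrX lerXn2r ?nnegrE // fg.
Qed.

Lemma sqint_mul (f g : X -> R) : sqint f -> sqint g ->
  mu.-integrable D (EFin \o (fun x => f x * g x)).
Proof.
move=> [mf If] [mg Ig].
have := integrable_addr If Ig; apply: le_integrable => //.
  by apply/measurable_EFinP; exact: measurable_funM.
move=> x Dx /=; rewrite lee_fin normrM [leRHS]ger0_norm ?addr_ge0 ?sqr_ge0 //.
rewrite -(real_normK (num_real (f x))) -(real_normK (num_real (g x))).
by nra.
Qed.

Lemma sqintD (f g : X -> R) : sqint f -> sqint g -> sqint (fun x => f x + g x).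
Proof.
move=> sf sg; have [[mf If] [mg Ig]] := (sf, sg); split.
  exact: measurable_funD.
have := integrableD mD (integrableD mD If Ig)
   (integrableZl mD 2 (sqint_mul sf sg)).
apply: eq_integrable => // x _ /=; rewrite -EFinM -!EFinD; congr EFin; ring.
Qed.

Lemma sqintZ (a : R) (f : X -> R) : sqint f -> sqint (fun x => a * f x).
Proof.
move=> [mf If]; split; first exact: measurable_funM.
have := integrableZl mD (a ^+ 2) If; apply: eq_integrable => // x _ /=.
by rewrite -EFinM exprMn.
Qed.

Lemma sqintB (f g : X -> R) : sqint f -> sqint g -> sqint (fun x => f x - g x).
Proof.
move=> sf sg; have := sqintD sf (sqintZ (-1) sg).
by under eq_fun do rewrite mulN1r.
Qed.

Lemma sqint_bounded (C : R) (f : X -> R) : (mu D < +oo)%E ->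
  measurable_fun D f -> (forall x, D x -> `|f x| <= C) -> sqint f.
Proof.
move=> muD mf fC; apply: (sqint_le mf (g := cst C)) => [x Dx|].
  exact: le_trans (fC x Dx) (ler_norm _).
split; first exact: measurable_cst.
apply: (@measurable_bounded_integrable _ _ _ _ (cst (C ^+ 2))) => //.
exists (C ^+ 2); split => [|M CM x _ /=]; first exact: num_real.
by rewrite ger0_norm ?sqr_ge0 // ltW.
Qed.

Lemma ae_le_Rintegral (f g : X -> R) : mu.-integrable D (EFin \o f) ->
  mu.-integrable D (EFin \o g) -> {ae mu, forall x, D x -> f x <= g x} ->
  \int[mu]_(x in D) f x <= \int[mu]_(x in D) g x.
Proof.
move=> If Ig [N [mN N0 fgN]].
rewrite -subr_ge0 -RintegralB //.
have Ih : mu.-integrable D (EFin \o (fun x => g x - f x)).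
  exact: integrable_subr.
rewrite /Rintegral (negligible_integral mN mD Ih N0).
apply: fine_ge0; apply: integral_ge0 => x [Dx Nx].
rewrite lee_fin subr_ge0; apply: contrapT => fgx.
by apply: Nx; apply: fgN => /= /(_ Dx).
Qed.

Lemma ae_eq_Rintegral (f g : X -> R) : mu.-integrable D (EFin \o f) ->
  mu.-integrable D (EFin \o g) -> {ae mu, forall x, D x -> f x = g x} ->
  \int[mu]_(x in D) f x = \int[mu]_(x in D) g x.
Proof.
move=> If Ig fg; apply/eqP; rewrite eq_le; apply/andP; split;
  by apply: ae_le_Rintegral => //; apply: filterS fg => x /[apply] ->.
Qed.

Lemma Rintegral_sum (I : Type) (s : seq I) (f : I -> X -> R) :
  (forall i, mu.-integrable D (EFin \o f i)) ->
  \int[mu]_(x in D) (\sum_(i <- s) f i x) = \sum_(i <- s) \int[mu]_(x in D) f i x.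
Proof.
move=> If; elim: s => [|i s IH].
  under eq_Rintegral do rewrite big_nil.
  by rewrite big_nil Rintegral_cst // mul0r.
under eq_Rintegral do rewrite big_cons.
rewrite big_cons -IH RintegralD //.
have : mu.-integrable D (fun x => \sum_(i <- s) (f i x)%:E)%E.
  by apply: integrable_sum => // j _; exact: If.
by apply: eq_integrable => // x _ /=; rewrite sumEFin.
Qed.

Lemma Rintegral_eq0 (f : X -> R) : mu.-integrable D (EFin \o f) ->
  (forall x, D x -> 0 <= f x) -> \int[mu]_(x in D) f x = 0 ->
  {ae mu, forall x, D x -> f x = 0}.
Proof.
move=> If f0 If0; have /integrableP[mf _] := If.
have : (\int[mu]_(x in D) `|(EFin \o f) x| = 0)%E.
  rewrite (eq_integral (EFin \o f)); last first.
    by move=> x; rewrite inE => Dx; rewrite gee0_abs //= lee_fin f0.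
  by rewrite -[LHS]fineK ?integrable_fin_num // -/(Rintegral mu D f) If0.
move=> /(ae_eq_integral_abs mu mD mf).
by apply: filterS => x H Dx; case: (H Dx).
Qed.

Definition sqintmx m n (A : X -> 'M[R]_(m, n)) :=
  forall i j, sqint (fun x => A x i j).

Definition dotL2 m n (A B : X -> 'M[R]_(m, n)) : R :=
  \int[mu]_(x in D) mxdot (A x) (B x).

Definition normL2 m n (A : X -> 'M[R]_(m, n)) : R := Num.sqrt (dotL2 A A).

Section tensor_fields.
Context {m n : nat}.
Implicit Types A B C : X -> 'M[R]_(m, n).

Lemma sqintmxD A B : sqintmx A -> sqintmx B -> sqintmx (fun x => A x + B x).
Proof.
move=> sA sB i j; under eq_fun do rewrite mxE.
exact: sqintD.
Qed.

Lemma sqintmxB A B : sqintmx A -> sqintmx B -> sqintmx (fun x => A x - B x).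
Proof.
move=> sA sB i j; under eq_fun do rewrite !mxE.
exact: sqintB.
Qed.

Lemma integrable_mxdot A B : sqintmx A -> sqintmx B ->
  mu.-integrable D (EFin \o (fun x => mxdot (A x) (B x))).
Proof.
move=> sA sB; rewrite /mxdot.
have : mu.-integrable D (fun x => \sum_i \sum_j (A x i j * B x i j)%:E)%E.
  by apply: integrable_sum => // i _; apply: integrable_sum => // j _; exact: sqint_mul.
apply: eq_integrable => // x _ /=; rewrite -sumEFin.
by apply: eq_bigr => i _; rewrite -sumEFin.
Qed.

Lemma dotL2C A B : dotL2 A B = dotL2 B A.
Proof. by apply: eq_Rintegral => x _; rewrite mxdotC. Qed.

Lemma dotL2Dl A B C : sqintmx A -> sqintmx B -> sqintmx C ->
  dotL2 (fun x => A x + B x) C = dotL2 A C + dotL2 B C.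
Proof.
move=> sA sB sC; rewrite -RintegralD //; try exact: integrable_mxdot.
by apply: eq_Rintegral => x _; rewrite mxdotDl.
Qed.

Lemma dotL2Bl A B C : sqintmx A -> sqintmx B -> sqintmx C ->
  dotL2 (fun x => A x - B x) C = dotL2 A C - dotL2 B C.
Proof.
move=> sA sB sC; rewrite -RintegralB //; try exact: integrable_mxdot.
by apply: eq_Rintegral => x _; rewrite mxdotBl.
Qed.

Lemma dotL2Br A B C : sqintmx A -> sqintmx B -> sqintmx C ->
  dotL2 C (fun x => A x - B x) = dotL2 C A - dotL2 C B.
Proof. by move=> sA sB sC; rewrite dotL2C dotL2Bl // !(dotL2C C). Qed.

Lemma dotL2_ge0 A : 0 <= dotL2 A A.
Proof. by apply: Rintegral_ge0 => x _; exact: mxdot_ge0. Qed.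

Lemma normL2_ge0 A : 0 <= normL2 A.
Proof. exact: sqrtr_ge0. Qed.

Lemma sqr_normL2 A : normL2 A ^+ 2 = dotL2 A A.
Proof. by rewrite sqr_sqrtr // dotL2_ge0. Qed.

Lemma dotL2_le A B : sqintmx A -> sqintmx B ->
  `|dotL2 A B| <= normL2 A * normL2 B.
Proof.
move=> sA sB.
rewrite -ler_sqr ?nnegrE ?mulr_ge0 ?normL2_ge0 // exprMn !sqr_normL2.
rewrite real_normK ?num_real //.
apply: discriminant_le => [||t]; rewrite ?dotL2_ge0 //.
have <- : \int[mu]_(x in D) mxdot (A x + t *: B x) (A x + t *: B x) =
    dotL2 A A + 2 * t * dotL2 A B + t ^+ 2 * dotL2 B B.
  rewrite -!RintegralZl -?RintegralD //; try exact: integrable_mxdot.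
  - apply: eq_Rintegral => x _.
    by rewrite !mxdotDl !mxdotDr !mxdotZl !mxdotZr (mxdotC (B x)); ring.
  - by apply: integrable_addr; [|apply: integrable_mulr]; exact: integrable_mxdot.
  - by apply: integrable_mulr; exact: integrable_mxdot.
  - by apply: integrable_mulr; exact: integrable_mxdot.
by apply: Rintegral_ge0 => x _; exact: mxdot_ge0.
Qed.

Lemma normL2D A B : sqintmx A -> sqintmx B ->
  normL2 (fun x => A x + B x) <= normL2 A + normL2 B.
Proof.
move=> sA sB.
rewrite -ler_sqr ?nnegrE ?addr_ge0 ?normL2_ge0 // sqr_normL2.
have sAB := sqintmxD sA sB.
rewrite dotL2Dl // !(dotL2C _ (fun x => A x + B x)) !dotL2Dl // (dotL2C B A).
have := dotL2_le sA sB; have := ler_norm (dotL2 A B).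
rewrite -!sqr_normL2; nra.
Qed.

Lemma normL2N A : normL2 (fun x => - A x) = normL2 A.
Proof.
congr Num.sqrt; apply: eq_Rintegral => x _.
by rewrite -scaleN1r mxdotZl mxdotZr mulrA mulrNN !mul1r.
Qed.

Lemma normL2B A B : sqintmx A -> sqintmx B ->
  normL2 (fun x => A x - B x) <= normL2 A + normL2 B.
Proof.
move=> sA sB; rewrite -(normL2N B); apply: normL2D => // i j.
by under eq_fun do rewrite mxE -mulN1r; exact: sqintZ.
Qed.

Lemma normL2_eq0 A : sqintmx A -> normL2 A = 0 ->
  {ae mu, forall x, D x -> A x = 0}.
Proof.
move=> sA A0; have : dotL2 A A = 0 by rewrite -sqr_normL2 A0 expr0n.
move=> /(Rintegral_eq0 (integrable_mxdot sA sA)).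
move=> /(_ (fun x _ => mxdot_ge0 _)); apply: filterS => x H Dx.
exact: mxdot_eq0 (H Dx).
Qed.

Lemma measurable_mxdot A B : 
  (forall i j, measurable_fun D (fun x => A x i j)) ->
  (forall i j, measurable_fun D (fun x => B x i j)) ->
  measurable_fun D (fun x => mxdot (A x) (B x)).
Proof.
move=> mA mB; apply: measurable_sum => i; apply: measurable_sum => j.
exact: measurable_funM.
Qed.

Lemma measurable_frob A :
  (forall i j, measurable_fun D (fun x => A x i j)) ->
  measurable_fun D (fun x => frob (A x)).
Proof.
move=> mA; have := measurable_mxdot mA mA => mAA.
have cs : measurable_fun [set: R] (@Num.sqrt R).
  by apply: continuous_measurable_fun => x; exact: sqrt_continuous.
exact: (measurableT_comp cs mAA).
Qed.

(** Reduces square integrability of a measurable field to bounds on its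
    pointwise norm. *)
Lemma sqintmxP A : sqintmx A <->
  (forall i j, measurable_fun D (fun x => A x i j)) /\ sqint (fun x => frob (A x)).
Proof.
split=> [sA|[mA sA] i j].
  have mA i j : measurable_fun D (fun x => A x i j) by case: (sA i j).
  split => //; split; first exact: measurable_frob.
  have := integrable_mxdot sA sA; apply: eq_integrable => // x _ /=.
  by rewrite sqr_frob.
apply: sqint_le sA => // x Dx.
by rewrite [leRHS]ger0_norm ?frob_ge0 // entry_le_frob.
Qed.

End tensor_fields.

Lemma measurable_outer m n (v : X -> 'rV[R]_m) (u : X -> 'rV[R]_n) :
  (forall i j, measurable_fun D (fun x => v x i j)) ->
  (forall i j, measurable_fun D (fun x => u x i j)) ->
  forall i j, measurable_fun D (fun x => ((v x)^T *m u x) i j).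
Proof.
move=> mv mw i j; under eq_fun do rewrite mxE big_ord1 mxE.
exact: measurable_funM.
Qed.

Lemma frob_outer m n (v : 'rV[R]_m) (u : 'rV[R]_n) :
  frob (v^T *m u) = frob v * frob u.
Proof. by rewrite /frob mxdot_outer sqrtrM // mxdot_ge0. Qed.

Definition L4field n (v : X -> 'rV[R]_n) :=
  (forall i j, measurable_fun D (fun x => v x i j)) /\
  sqint (fun x => frob (v x) ^+ 2).

(** Fourth power of the L4 norm. *)
Definition int4 n (v : X -> 'rV[R]_n) : R := \int[mu]_(x in D) frob (v x) ^+ 4.

(** Pointwise |v| |u| <= |v|^2 + |u|^2, and both squares are square
    integrable. *)
Lemma sqintmx_outer m n (v : X -> 'rV[R]_m) (u : X -> 'rV[R]_n) :
  L4field v -> L4field u -> sqintmx (fun x => (v x)^T *m u x).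
Proof.
move=> [mv sv] [mw su]; apply/sqintmxP; split; first exact: measurable_outer.
under eq_fun do rewrite frob_outer.
apply: sqint_le (sqintD sv su).
  by apply: measurable_funM; exact: measurable_frob.
move=> x Dx; rewrite !ger0_norm ?addr_ge0 ?sqr_ge0 ?mulr_ge0 ?frob_ge0 //.
by have := frob_ge0 (v x); have := frob_ge0 (u x); nra.
Qed.

(** Cauchy-Schwarz for the scalar fields |v|^2 and |u|^2.  They are encoded as
    1 x 1 tensors so that the inequality for tensor fields applies; fourth
    powers avoid fourth roots. *)
Lemma normL2_outer m n (v : X -> 'rV[R]_m) (u : X -> 'rV[R]_n) :
  L4field v -> L4field u ->
  normL2 (fun x => (v x)^T *m u x) ^+ 4 <= int4 v * int4 u.
Proof.
move=> [mv sv] [mw su].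
pose V x : 'M[R]_1 := (frob (v x) ^+ 2)%:M.
pose U x : 'M[R]_1 := (frob (u x) ^+ 2)%:M.
have sV : sqintmx V.
  by move=> i j; rewrite (ord1 i) (ord1 j); under eq_fun do rewrite mxE.
have sU : sqintmx U.
  by move=> i j; rewrite (ord1 i) (ord1 j); under eq_fun do rewrite mxE.
have dotE (a b : R) : mxdot (a%:M : 'M[R]_1) (b%:M) = a * b.
  by rewrite /mxdot !big_ord1 !mxE.
have -> : int4 v = dotL2 V V.
  by apply: eq_Rintegral => x _; rewrite dotE -exprD.
have -> : int4 u = dotL2 U U.
  by apply: eq_Rintegral => x _; rewrite dotE -exprD.
rewrite -!sqr_normL2 -[in leRHS]exprMn (exprM _ 2 2) sqr_normL2.
rewrite ler_sqr ?nnegrE ?mulr_ge0 ?normL2_ge0 ?dotL2_ge0 //.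
have -> : dotL2 (fun x => (v x)^T *m u x) (fun x => (v x)^T *m u x) = dotL2 V U.
  by apply: eq_Rintegral => x _; rewrite dotE mxdot_outer !sqr_frob.
exact: le_trans (ler_norm _) (dotL2_le sV sU).
Qed.

End square_integrable.

(** * Integrating a derivative over R^n *)

Section affine_line.
Context {R : realType} {V W : normedModType R}.
Variables (g : V -> W) (a v : V) (w : W).
Hypothesis gE : forall h : R, g (h *: v + a) = h *: w + g a.

Let quotientE (f : W -> R) :
  (fun h : R => h^-1 *: ((f \o g \o shift a) (h *: v) - (f \o g) a)) =
  (fun h : R => h^-1 *: ((f \o shift (g a)) (h *: w) - f (g a))).
Proof. by apply/funext => h; rewrite /= gE. Qed.

(** Difference quotients do not see a map that is affine along the line of
    differentiation; used for the embeddings of R and R^n in R^(n+1). *)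
Lemma derivable_affine_line (f : W -> R) :
  derivable f (g a) w -> derivable (f \o g) a v.
Proof. by rewrite /derivable quotientE. Qed.

Lemma derive_affine_line (f : W -> R) : 'D_v (f \o g) a = 'D_w f (g a).
Proof. by rewrite /derive quotientE. Qed.

End affine_line.

Section cons_rV_theory.
Context {R : realType} {n : nat}.
Implicit Types (t : R) (y : 'rV[R]_n).

Lemma cons_rVE0 t y : @cons_rV R n (t, y) 0 0 = t.
Proof.
rewrite /cons_rV mxE; case: fintype.splitP => // j _.
by rewrite (ord1 j) mxE eqxx.
Qed.

Lemma cons_rVES t y k : @cons_rV R n (t, y) 0 (lift 0 k) = y 0 k.
Proof.
rewrite /cons_rV mxE; case: fintype.splitP => [j|j] /=.
  by rewrite (ord1 j).
by rewrite /bump leq0n => -[/val_inj ->].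
Qed.

Lemma cons_rV_eq (x x' : 'rV[R]_n.+1) : x 0 0 = x' 0 0 ->
  (forall k, x 0 (lift 0 k) = x' 0 (lift 0 k)) -> x = x'.
Proof.
move=> x0 xS; apply/matrixP => i j; rewrite (ord1 i).
case: (unliftP 0 j) => [k|] ->; [exact: xS|exact: x0].
Qed.

Let entryD (h : R) (x x' : 'rV[R]_n.+1) j :
  (h *: x + x') 0 j = h * x 0 j + x' 0 j.
Proof. by rewrite !mxE. Qed.

Lemma cons_rV_line0 (h t : R) y :
  cons_rV (h *: 1 + t, y) = h *: 'e_0 + cons_rV (t, y).
Proof.
apply: cons_rV_eq => [|k]; rewrite entryD ?cons_rVE0 ?cons_rVES mxE eqxx /=.
  by [].
by rewrite mulr0 add0r.
Qed.

Lemma cons_rV_lineS (h t : R) y k :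
  cons_rV (t, h *: 'e_k + y) = h *: 'e_(lift 0 k) + cons_rV (t, y).
Proof.
apply: cons_rV_eq => [|l]; rewrite entryD ?cons_rVE0 ?cons_rVES.
  by rewrite mxE eqxx andTb (negPf (neq_lift _ _)) mulr0 add0r.
by rewrite !mxE (inj_eq lift_inj).
Qed.

Lemma continuous_cons_rV_l y : continuous (fun t : R => cons_rV (t, y)).
Proof.
move=> t; apply/cvgrPdist_lt => e e0; near=> t'.
have tt' : `|t - t'| < e by near: t'; exact: cvgr_dist_lt.
have : ball (cons_rV (t, y)) e (cons_rV (t', y)).
  split => // i j; rewrite (ord1 i); case: (unliftP 0 j) => [k|] ->.
    by rewrite !cons_rVES; exact: ballxx.
  by rewrite !cons_rVE0.
by rewrite mx_norm_ball.
Unshelve. all: by end_near. Qed.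

Lemma continuous_cons_rV_r t : continuous (fun y => cons_rV (t, y)).
Proof.
move=> y; apply/(@cvgrPdist_lt _ _ _ (nbhs y)) => e e0.
apply: (@filterS _ (nbhs y) _ (ball y e)) (nbhsx_ballx y e e0) => y' [_ yy'].
have : ball (cons_rV (t, y)) e (cons_rV (t, y')).
  split => // i j; rewrite (ord1 i); case: (unliftP 0 j) => [k|] ->.
    by rewrite !cons_rVES.
  by rewrite !cons_rVE0; exact: ballxx.
by rewrite mx_norm_ball.
Qed.

End cons_rV_theory.

Section cubes.
Context {R : realType}.

Definition cube n (M : R) : set 'rV[R]_n :=
  [set x | forall j, `[- M, M]%classic (x 0 j)].

Lemma compact_cube n M : compact (@cube n M).
Proof.
apply: (@rV_compact _ _ (fun=> `[- M, M]%classic)) => j.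
exact: segment_compact.
Qed.

Lemma closed_cube n M : closed (@cube n M).
Proof. by apply: (compact_closed _ (@compact_cube n M)); exact: norm_hausdorff. Qed.

Lemma measurable_cube n M : measurable (@cube n M).
Proof.
have <- : ~` (~` @cube n M) = cube M by rewrite setCK.
apply: measurableC; apply: open_measurable_rV; apply: closed_openC.
exact: closed_cube.
Qed.

Lemma lebesgue_cube_lty n M : (lebesgue_rV n (@cube n M) < +oo)%E.
Proof.
elim: n => [|n IH] /=.
  by rewrite diracE ltry.
rewrite /lebesgue_rV_step /pushforward.
have -> : @cons_rV R n @^-1` cube M = `[- M, M]%classic `*` cube M.
  apply/seteqP; split=> -[t y] /=.
    move=> H; split; first by rewrite /= -(cons_rVE0 t y); exact: H.
    by move=> j /=; rewrite -(cons_rVES t); exact: H.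
  move=> [tM yM] j; case: (unliftP 0 j) => [k|] ->.
    by rewrite cons_rVES; exact: yM.
  by rewrite cons_rVE0.
rewrite product_measure1E //; last exact: measurable_cube.
apply: lte_mul_pinfty; rewrite ?measure_ge0 //.
  have : (@lebesgue_measure R `[(- M)%R, M]%classic < +oo)%E.
    by rewrite lebesgue_measure_itv /=; case: ifP => _; rewrite ?ltry // -EFinB ltry.
  by rewrite ge0_fin_numE.
Qed.

Definition supp_in_cube n M (f : 'rV[R]_n -> R) := forall x, ~ cube M x -> f x = 0.

Lemma integrable_supp_in_cube n M (f : 'rV[R]_n -> R) :
  continuous f -> supp_in_cube M f ->
  (lebesgue_rV n).-integrable setT (EFin \o f).
Proof.
move=> cf f0; have mK := measurable_cube (n := n) M.
have mf := continuous_measurable_fun_rV cf.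
have <- : (EFin \o f) \_ (cube M) = EFin \o f.
  apply/funext => x; rewrite patchE; case: ifPn => //.
  by rewrite notin_setE /= => /f0 ->.
apply/(integrable_mkcond _ mK)/measurable_bounded_integrable => //.
- exact: lebesgue_cube_lty.
- exact: measurable_funS mf.
have /compact_bounded : compact (f @` cube M).
  by apply: continuous_compact; [exact: continuous_subspaceT|exact: compact_cube].
rewrite /bounded_near /=; apply: filter_app; near=> N => /= fN x Kx.
by apply: fN; exists x.
Unshelve. all: by end_near. Qed.

Lemma supp_in_cube_partial n M j (f : 'rV[R]_n -> R) :
  supp_in_cube M f -> supp_in_cube M (partial j f).
Proof.
move=> f0 x Kx; rewrite /partial.
have oK : open (~` @cube n M) by apply: closed_openC; exact: closed_cube.
rewrite (@near_eq_derive _ _ _ _ (cst 0)) ?derive_cst //.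
have : nbhs x (~` @cube n M) by apply: open_nbhs_nbhs; split.
by apply: filterS => y /f0 ->.
Qed.

(** On a line, a derivative with compact support integrates to zero by the
    fundamental theorem of calculus. *)
Lemma integral_derive1_eq0 (M : R) (f : R -> R) :
  (forall t : R, derivable f t 1) -> continuous (derive1 f) ->
  (forall t : R, ~ `[- M, M]%classic t -> f t = 0) ->
  (\int[lebesgue_measure]_t (derive1 f t)%:E = 0)%E.
Proof.
move=> df cf f0.
(* One more than |M|, so that f vanishes at both end points. *)
pose N : R := `|M| + 1; have MN : `|M| < N by rewrite ltrDl.
have N0 : 0 < N by exact: le_lt_trans MN.
have f'0 (t : R) : ~ `[- N, N]%classic t -> derive1 f t = 0.
  move=> Nt; rewrite derive1E (@near_eq_derive _ _ _ _ (cst 0)) ?derive_cst //.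
  have : nbhs t (~` `[- M, M]%classic).
    apply: open_nbhs_nbhs; split; first exact/closed_openC/interval_closed.
    move=> /=; apply: contra_not Nt; rewrite /= !in_itv /=.
    by have := ler_norm M; have := ler_norm (- M); rewrite normrN; lra.
  by apply: filterS => s /f0.
have -> : (\int[lebesgue_measure]_t (derive1 f t)%:E =
    \int[lebesgue_measure]_(t in `[(- N)%R, N]) (derive1 f t)%:E)%E.
  rewrite [RHS]integral_mkcond; apply: eq_integral => t _.
  rewrite patchE; case: ifPn => //.
  by rewrite notin_setE => /f'0 ->.
have cf0 : continuous f.
  by move=> t; apply: differentiable_continuous; exact/derivable1_diffP.
rewrite (@continuous_FTC2 _ _ f).
- rewrite !f0 ?sube0 //= in_itv /=.
    by have := ler_norm M; have := ler_norm (- M); rewrite normrN; lra.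
  by have := ler_norm M; have := ler_norm (- M); rewrite normrN; lra.
- lra.
- exact: continuous_subspaceT.
- split => [t _||]; first exact: df.
    by apply: cvg_at_right_filter; exact: cf0.
  by apply: cvg_at_left_filter; exact: cf0.
- by [].
Qed.

(** By induction on the dimension.  A derivative in the first variable is
    integrated first in that variable, where the one-dimensional statement
    applies; any other derivative is first integrated in the remaining
    variables, where the induction hypothesis applies. *)
Lemma integral_partial_eq0 n M j (f : 'rV[R]_n -> R) :
  (forall x, derivable f x 'e_j) -> continuous (partial j f) ->
  supp_in_cube M f ->
  (\int[lebesgue_rV n]_x (partial j f x)%:E = 0)%E.
Proof.
elim: n j f => [[]//|n IH] j f df cf f0.
have f'0 := supp_in_cube_partial j f0.
have If := integrable_supp_in_cube cf f'0.
have mf := continuous_measurable_fun_rV cf.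
have Ifc : (lebesgue_measure \x lebesgue_rV n)%E.-integrable setT
    ((EFin \o partial j f) \o @cons_rV R n).
  have mcons := @measurable_cons_rV R n.
  apply/integrableP; split.
    by apply: measurableT_comp => //; exact/measurable_EFinP.
  have /integrableP[_] := If; apply: le_lt_trans.
  rewrite (@ge0_integral_pushforward _ _ _ _ _ _ mcons
    (lebesgue_measure \x lebesgue_rV n)%E setT) //.
  by apply/measurableT_comp => //; exact/measurable_EFinP.
transitivity (\int[lebesgue_measure \x lebesgue_rV n]_p
    (EFin \o partial j f \o @cons_rV R n) p)%E.
  apply: (@integral_pushforward _ _ _ _ _ _ (@measurable_cons_rV R n)
     (lebesgue_measure \x lebesgue_rV n)%E setT) => //.
  exact/measurable_EFinP.
case: (unliftP 0 j) => [k|] jE; rewrite jE in df cf f'0 If mf Ifc *.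
  rewrite -integral12_prod_meas1 //; apply: integral0_eq => t _.
  rewrite /fubini_F /=.
  have pE (y : 'rV[R]_n) : partial (k : 'I_n) (fun y => f (cons_rV (t, y))) y =
      partial (lift 0 k) f (cons_rV (t, y)).
    exact: (@derive_affine_line R _ _ (fun y => cons_rV (t, y)) y
      'e_k _ (fun h => cons_rV_lineS h t y k) f).
  rewrite -[RHS](IH k (fun y => f (cons_rV (t, y)))).
  - by apply: eq_integral => y _; rewrite pE.
  - move=> y; exact: (@derivable_affine_line R _ _ (fun y => cons_rV (t, y)) y
      'e_k _ (fun h => cons_rV_lineS h t y k) f (df _)).
  - rewrite (_ : partial k _ = partial (lift 0 k) f \o (fun y => cons_rV (t, y))).
      move=> y; apply: continuous_comp; first exact: continuous_cons_rV_r.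
      exact: cf.
    by apply/funext => y; exact: pE.
  - move=> y Ky; apply: f0; apply: contra_not Ky => Kc l.
    by have := Kc (lift 0 l); rewrite cons_rVES.
rewrite -integral21_prod_meas1 //; apply: integral0_eq => y _.
rewrite /fubini_G /=.
have pE t : derive1 (fun t => f (cons_rV (t, y))) t = partial 0 f (cons_rV (t, y)).
  rewrite derive1E; exact: (@derive_affine_line R _ _ (fun t => cons_rV (t, y)) t
    1 _ (fun h => cons_rV_line0 h t y) f).
rewrite -[RHS](@integral_derive1_eq0 M (fun t => f (cons_rV (t, y)))).
- by apply: eq_integral => t _; rewrite pE.
- move=> t; exact: (@derivable_affine_line R _ _ (fun t => cons_rV (t, y)) t
    1 _ (fun h => cons_rV_line0 h t y) f (df _)).
- rewrite (_ : derive1 _ = partial 0 f \o (fun t => cons_rV (t, y))).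
    move=> t; apply: continuous_comp; first exact: continuous_cons_rV_l.
    exact: cf.
  by apply/funext => t; exact: pE.
- move=> t Mt; apply: f0; apply: contra_not Mt => Kc.
  by have := Kc 0; rewrite cons_rVE0.
Qed.

End cubes.

(** * Test functions *)

Section smooth.
Context {R : realType} {n : nat}.
Implicit Types f g : 'rV[R]_n -> R.

(** A variant of [smooth] by recursion on the order: smoothness of products
    then follows from the Leibniz rule by a plain induction, whereas iterated
    partial derivatives of a product have no simple closed form.  Order 0
    already asks for the existence of the first partial derivatives. *)
Fixpoint diff_upto k f : Prop :=
  [/\ continuous f, forall j x, derivable f x 'e_j &
      if k is k'.+1 then forall j, diff_upto k' (partial j f) else True].

Lemma diff_uptoW k f : diff_upto k.+1 f -> diff_upto k f.
Proof.
elim: k f => [|k IH] f [cf df Hf]; split => // j.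
exact: IH.
Qed.

Lemma smoothP f : smooth f <-> forall k, diff_upto k f.
Proof.
split=> [Hf k|Hf s].
  elim: k f Hf => [|k IH] f Hf; have [cf df] := Hf [::]; split => // j.
  by apply: IH => s /=; have := Hf (rcons s j); rewrite foldr_rcons.
elim/last_ind: s f Hf => [|s j IH] f Hf /=.
  by have [cf df _] := Hf 0.
rewrite foldr_rcons; apply: IH => k.
by have [_ _ /(_ j)] := Hf k.+1.
Qed.

Lemma partialD j f g : (forall x, derivable f x 'e_j) ->
  (forall x, derivable g x 'e_j) ->
  partial j (fun x => f x + g x) = (fun x => partial j f x + partial j g x).
Proof. by move=> df dg; apply/funext => x; exact: deriveD. Qed.

Lemma partialM j f g : (forall x, derivable f x 'e_j) ->
  (forall x, derivable g x 'e_j) ->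
  partial j (fun x => f x * g x) =
  (fun x => partial j f x * g x + f x * partial j g x).
Proof.
move=> df dg; apply/funext => x; rewrite /partial.
have -> : 'D_('e_j) (fun x => f x * g x) x =
    f x *: 'D_('e_j) g x + g x *: 'D_('e_j) f x.
  exact: deriveM.
by rewrite addrC; congr (_ + _); exact: mulrC.
Qed.

Lemma diff_uptoD k f g : diff_upto k f -> diff_upto k g ->
  diff_upto k (fun x => f x + g x).
Proof.
elim: k f g => [|k IH] f g [cf df Hf] [cg dg Hg]; split => //.
- by move=> x; exact: (continuousD (cf x) (cg x)).
- by move=> j x; exact: derivableD.
- by move=> x; exact: (continuousD (cf x) (cg x)).
- by move=> j x; exact: derivableD.
- move=> j; rewrite partialD; [|exact: df|exact: dg].
  by apply: IH; [exact: Hf|exact: Hg].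
Qed.

Lemma diff_uptoM k f g : diff_upto k f -> diff_upto k g ->
  diff_upto k (fun x => f x * g x).
Proof.
elim: k f g => [|k IH] f g Ff Fg; have [cf df Hf] := Ff;
  have [cg dg Hg] := Fg; split => //.
- by move=> x; exact: (continuousM (cf x) (cg x)).
- by move=> j x; exact: derivableM.
- by move=> x; exact: (continuousM (cf x) (cg x)).
- by move=> j x; exact: derivableM.
- move=> j; rewrite partialM; [|exact: df|exact: dg].
  by apply: diff_uptoD; apply: IH; try exact: diff_uptoW; [exact: Hf|exact: Hg].
Qed.

Lemma diff_upto_cst k (c : R) : diff_upto k (cst c).
Proof.
elim: k c => [|k IH] c; split => //; try exact: cst_continuous.
move=> j; rewrite (_ : partial j _ = cst 0) //.
by apply/funext => x; rewrite /partial derive_cst.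
Qed.

Lemma smoothM f g : smooth f -> smooth g -> smooth (fun x => f x * g x).
Proof. by move=> /smoothP sf /smoothP sg; apply/smoothP => k; exact: diff_uptoM. Qed.

Lemma smoothB f g : smooth f -> smooth g -> smooth (fun x => f x - g x).
Proof.
move=> /smoothP sf /smoothP sg; apply/smoothP => k; apply: diff_uptoD => //.
under eq_fun do rewrite -mulN1r.
by apply: diff_uptoM => //; exact: diff_upto_cst.
Qed.

Lemma smooth_cst c : smooth (cst c : 'rV[R]_n -> R).
Proof. by apply/smoothP => k; exact: diff_upto_cst. Qed.

Lemma smooth_partial j f : smooth f -> smooth (partial j f).
Proof. by move=> /smoothP sf; apply/smoothP => k; have [_ _ /(_ j)] := sf k.+1. Qed.

Lemma smooth_continuous f : smooth f -> continuous f.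
Proof. by move=> /(_ [::]) []. Qed.

Lemma smooth_derivable f j x : smooth f -> derivable f x 'e_j.
Proof. by move=> /(_ [::]) []. Qed.

End smooth.

Section test_functions.
Context {R : realType} {n : nat} (Omega : set 'rV[R]_n).
Implicit Types f g : 'rV[R]_n -> R.
Local Notation leb := (lebesgue_rV n).
Local Notation test := (test_function Omega).

Let suppS f g : (forall x, g x = 0 -> f x = 0) ->
  closure [set x | f x != 0] `<=` closure [set x | g x != 0].
Proof. by move=> fg; apply: closureS => x /=; apply: contra_neq => /fg. Qed.

Lemma test_le f g : test g -> smooth f ->
  closure [set x | f x != 0] `<=` closure [set x | g x != 0] -> test f.
Proof.
move=> [_ kg gO] sf fg; split => //; last exact: subset_trans gO.
by apply: subclosed_compact kg fg; exact: closed_closure.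
Qed.

Lemma test0 : test (cst 0).
Proof.
have supp0 : closure [set x | (cst 0 : 'rV[R]_n -> R) x != 0] = set0.
  rewrite (_ : [set _ | _] = set0) ?closure0 //.
  by apply/seteqP; split=> x //=; rewrite eqxx.
split; [exact: smooth_cst| |]; rewrite supp0; first exact: compact0.
exact: sub0set.
Qed.

Lemma testB f g : test f -> test g -> test (fun x => f x - g x).
Proof.
move=> [sf kf fO] [sg kg gO].
have H : closure [set x | f x - g x != 0] `<=`
    closure [set x | f x != 0] `|` closure [set x | g x != 0].
  rewrite -closureU; apply: closureS => x /= fgx.
  have [fx|fx] := eqVneq (f x) 0; last by left.
  by right; apply: contra_neq fgx => gx; rewrite fx gx subr0.
split; first exact: smoothB.
  by apply: subclosed_compact H; [exact: closed_closure|exact: compactU].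
by apply: subset_trans H _ => x [/fO|/gO].
Qed.

Lemma testM f g : test f -> smooth g -> test (fun x => f x * g x).
Proof.
move=> tf sg; have [sf _ _] := tf; apply: (test_le tf); first exact: smoothM.
by apply: suppS => x ->; rewrite mul0r.
Qed.

Let partial_off_supp f j x : ~ closure [set x | f x != 0] x -> partial j f x = 0.
Proof.
move=> fx; rewrite /partial (@near_eq_derive _ _ _ _ (cst 0)) ?derive_cst //.
have : nbhs x (~` closure [set x | f x != 0]).
  by apply: open_nbhs_nbhs; split => //; exact/closed_openC/closed_closure.
apply: (@filterS _ (nbhs x)) => y fy; apply: contrapT => /eqP fy0; apply: fy.
exact: subset_closure.
Qed.

Lemma test_partial f j : test f -> test (partial j f).
Proof.
move=> tf; have [sf _ _] := tf; apply: (test_le tf); first exact: smooth_partial.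
have := @closed_closure _ [set x | f x != 0] => /closure_id ->.
apply: closureS => x /= f'x; apply: contrapT => /partial_off_supp fx.
by rewrite fx eqxx in f'x.
Qed.

Lemma test_off f x : test f -> ~ Omega x -> f x = 0.
Proof.
move=> [_ _ fO] Ox; apply: contrapT => /eqP fx; apply: Ox; apply: fO.
exact: subset_closure.
Qed.

Lemma test_supp_in_cube f : test f -> exists M, supp_in_cube M f.
Proof.
move=> [_ kf _]; have [M [_ MP]] := compact_bounded kf.
exists (`|M| + 1) => x Mx; apply: contrapT => /eqP fx; apply: Mx => j /=.
have : `|x| <= `|M| + 1.
  apply: (MP (`|M| + 1)); last exact: subset_closure.
  by rewrite ltr_pwDr // ler_norm.
rewrite in_itv /= -ler_norml; apply: le_trans.
by rewrite [leRHS]/Num.Def.normr /= mx_normrE; apply/bigmax_geP; right; exists (0, j).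
Qed.

Hypothesis mO : measurable Omega.

Lemma test_sqint f : test f -> sqint leb Omega f.
Proof.
move=> tf; have [M fM] := test_supp_in_cube tf.
have [/smooth_continuous cf _ _] := tf; split.
  by apply: measurable_funS (continuous_measurable_fun_rV cf).
apply: (@integrableS _ _ _ _ setT) => //.
apply: (@integrable_supp_in_cube _ _ M).
  move=> x; apply: continuous_comp (@exprn_continuous _ _ _); exact: cf.
by move=> x /fM ->; rewrite expr0n.
Qed.

Lemma integral_test_partial_eq0 f j : test f ->
  \int[leb]_(x in Omega) partial j f x = 0.
Proof.
move=> tf; have [M fM] := test_supp_in_cube tf; have [sf _ _] := tf.
rewrite Rintegral_mkcond (_ : _ \_ _ = partial j f); last first.
  apply/funext => x; rewrite patchE; case: ifPn => //.
  by rewrite notin_setE => /(test_off (test_partial j tf)).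
rewrite /Rintegral (@integral_partial_eq0 _ _ M) // => [x|].
  exact: smooth_derivable.
by apply: smooth_continuous; exact: smooth_partial.
Qed.

(** The derivative of the test function f g integrates to zero. *)
Lemma test_integration_by_parts f g j : test f -> test g ->
  \int[leb]_(x in Omega) (f x * partial j g x) =
  - \int[leb]_(x in Omega) (partial j f x * g x).
Proof.
move=> tf tg; have [sf _ _] := tf; have [sg _ _] := tg.
have := integral_test_partial_eq0 j (testM tf sg).
rewrite partialM; try by move=> x; exact: smooth_derivable.
rewrite RintegralD //; last 2 first.
- by apply: sqint_mul => //; apply: test_sqint => //; exact: test_partial.
- by apply: sqint_mul => //; apply: test_sqint => //; exact: test_partial.
by move=> /eqP; rewrite addr_eq0 => /eqP ->; rewrite opprK.
Qed.

End test_functions.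

(** * The norms of the Lebesgue spaces *)

Section norms.
Context {R : realType} {n : nat} (Omega : set 'rV[R]_n).
Hypothesis mO : measurable Omega.
Local Notation leb := (lebesgue_rV n).
Local Notation sqi := (sqint leb Omega).
Local Notation sqm := (sqintmx leb Omega).
Local Notation norm := (normL2 leb Omega).
Local Notation dot := (dotL2 leb Omega).
Implicit Types f g : 'rV[R]_n -> R.

(** Natural powers of the norm, to get rid of real exponents for p = 2, 4. *)
Lemma LpNorm_pow (k : nat) f : (0 < k)%N ->
  (LpNorm Omega k%:R f `^ k%:R = \int[leb]_(x in Omega) (`|f x| ^+ k)%:E)%E.
Proof.
move=> k0; rewrite /LpNorm powR_Lnorm; last by rewrite pnatr_eq0 -lt0n.
rewrite [RHS]integral_mkcond; apply: eq_integral => x _ /=.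
rewrite !patchE; case: ifPn => _; first by rewrite powR_mulrn.
by rewrite normr0 powR0 // pnatr_eq0 -lt0n.
Qed.

Lemma LpNorm_ge0 (p : R) f : (0 <= LpNorm Omega p f)%E.
Proof. exact: Lnorm_ge0. Qed.

Lemma LpNorm2E f : sqi f ->
  LpNorm Omega 2 f = (Num.sqrt (\int[leb]_(x in Omega) f x ^+ 2))%:E.
Proof.
move=> [mf If]; have := @LpNorm_pow 2 f isT.
under eq_integral do rewrite real_normK ?num_real //.
have := LpNorm_ge0 2 f; case: (LpNorm Omega 2 f) => [r||] // r0.
- rewrite poweR_EFin powR_mulrn // => H; congr EFin.
  by rewrite /Rintegral -H /= sqrtr_sqr ger0_norm.
- rewrite poweRyr ?pnatr_eq0 // => H.
  by have := integrable_fin_num mO If; rewrite -H.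
Qed.

Lemma LpNorm2_fieldE m k (A : 'rV[R]_n -> 'M[R]_(m, k)) : sqm A ->
  LpNorm Omega 2 (frob \o A) = (norm A)%:E.
Proof.
move=> /sqintmxP-/(_ mO)[_ sA]; rewrite LpNorm2E //; congr (Num.sqrt _)%:E.
by apply: eq_Rintegral => x _; rewrite sqr_frob.
Qed.

Lemma sqintmx_scalar f : sqi f -> sqm (fun x => (f x)%:M : 'M[R]_1).
Proof. by move=> sf i j; rewrite (ord1 i) (ord1 j); under eq_fun do rewrite mxE. Qed.

Lemma LpNorm2_scalarE f : sqi f ->
  LpNorm Omega 2 f = (norm (fun x => (f x)%:M : 'M[R]_1))%:E.
Proof.
move=> sf; rewrite LpNorm2E //; congr (Num.sqrt _)%:E.
by apply: eq_Rintegral => x _; rewrite /mxdot !big_ord1 mxE.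
Qed.

Lemma normL2_0 m k : norm (fun _ => 0 : 'M[R]_(m, k)) = 0.
Proof.
rewrite /normL2 /dotL2; under eq_Rintegral do rewrite mxdot0l.
by rewrite Rintegral_cst // mul0r sqrtr0.
Qed.

Lemma LpNorm4_le k (v : 'rV[R]_n -> 'rV[R]_k) (c : R) : 0 <= c ->
  (forall i j, measurable_fun Omega (fun x => v x i j)) ->
  (LpNorm Omega 4 (frob \o v) <= c%:E)%E ->
  L4field leb Omega v /\ int4 leb Omega v <= c ^+ 4.
Proof.
move=> c0 mv Hc; have := @LpNorm_pow 4 (frob \o v) isT.
have := LpNorm_ge0 4 (frob \o v); move: Hc.
case: (LpNorm Omega 4 (frob \o v)) => [r||] //; rewrite !lee_fin => rc r0.
rewrite poweR_EFin powR_mulrn // => H.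
have mf := measurable_frob mv.
have HE : (\int[leb]_(x in Omega) (frob (v x) ^+ 4)%:E = (r ^+ 4)%:E)%E.
  by rewrite H; apply: eq_integral => x _; rewrite ger0_norm ?frob_ge0.
split; last first.
  by rewrite /int4 /Rintegral HE /= lerXn2r ?nnegrE.
split => //; split; first exact: measurable_funX.
apply/integrableP; split.
  by apply/measurable_EFinP; apply: measurable_funX; exact: measurable_funX.
rewrite (_ : integral _ _ _ = (r ^+ 4)%:E) ?ltry // -HE.
by apply: eq_integral => x _ /=; rewrite -exprM ger0_norm // exprn_ge0 // frob_ge0.
Qed.

Lemma L2P f : L2 Omega f <-> sqi f.
Proof.
rewrite /L2; split=> [Hf|sf].
  have := Lfun2_integrable_sqr Hf; move: Hf; rewrite inE => /andP[+ _].
  rewrite inE /= => /(measurable_restrictT _ mO) mf If; split => //.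
  apply/(integrable_mkcond _ mO); move: If; apply: eq_integrable => // x _ /=.
  by rewrite !patchE; case: ifPn => //= _; rewrite expr0n.
rewrite inE; apply/andP; split; rewrite inE /=.
  by apply/(measurable_restrictT _ mO); case: sf.
have := LpNorm2E sf; rewrite /LpNorm /finite_norm => ->.
exact: ltry.
Qed.

Lemma L2fieldP m k (A : 'rV[R]_n -> 'M[R]_(m, k)) : L2field Omega A <-> sqm A.
Proof. by split=> H i j; apply/L2P; exact: H. Qed.

End norms.

(** * Sobolev spaces and the convection form *)

Section sobolev_spaces.
Context {R : realType} {n : nat} (Omega : set 'rV[R]_n).
Hypothesis mO : measurable Omega.
Local Notation leb := (lebesgue_rV n).
Local Notation sqi := (sqint leb Omega).
Local Notation sqm := (sqintmx leb Omega).
Local Notation norm := (normL2 leb Omega).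
Local Notation dot := (dotL2 leb Omega).
Local Notation test := (test_function Omega).

(** Integration by parts makes the classical gradient a weak one; the
    approximating sequence is constant. *)
Lemma H10_test (phi : 'rV[R]_n -> R) : test phi -> H10 Omega phi (grad phi).
Proof.
move=> tphi; have sp j : sqi (partial j phi).
  by apply: test_sqint => //; exact: test_partial.
split.
- by apply/L2P => //; exact: test_sqint.
- by move=> i j; apply/L2P => //; under eq_fun do rewrite mxE.
- move=> psi tpsi j; rewrite test_integration_by_parts //.
  by congr (- _); apply: eq_Rintegral => x _; rewrite mxE.
- move=> e e0; exists phi; split => //.
    rewrite (_ : (fun x => _) = cst 0); last by apply/funext => x; rewrite subrr.
    rewrite LpNorm2_scalarE //; last by apply: test_sqint => //; exact: test0.
    by under eq_fun do rewrite raddf0; rewrite normL2_0 // lte_fin.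
  rewrite (_ : (fun x => _) = frob \o (fun _ => 0 : 'rV[R]_n)); last first.
    by apply/funext => x /=; rewrite subrr.
  rewrite LpNorm2_fieldE ?normL2_0 ?lte_fin // => i j.
  under eq_fun do rewrite mxE.
  by apply: test_sqint => //; exact: test0.
Qed.

Lemma H10B u g u' g' : H10 Omega u g -> H10 Omega u' g' ->
  H10 Omega (fun x => u x - u' x) (fun x => g x - g' x).
Proof.
move=> [/(L2P mO) su /(L2fieldP mO) sg wu du] [/(L2P mO) su' /(L2fieldP mO) sg' wu' du'].
split.
- by apply/L2P => //; exact: sqintB.
- by apply/L2fieldP => //; exact: sqintmxB.
- move=> phi tphi j.
  have sphi : sqi phi by exact: test_sqint.
  have sphi' : sqi (partial j phi) by apply: test_sqint => //; exact: test_partial.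
  under eq_Rintegral do rewrite mulrBl.
  rewrite RintegralB //; try exact: sqint_mul.
  rewrite wu // wu' // opprK addrC -opprB -RintegralB //; try exact: sqint_mul.
  by congr (- _); apply: eq_Rintegral => x _; rewrite !mxE mulrBl.
- move=> e e0; have e20 : 0 < e / 2 by rewrite divr_gt0.
  have [phi [tphi d1 d2]] := du _ e20; have [phi' [tphi' d1' d2']] := du' _ e20.
  have [sphi sphi'] := (test_sqint mO tphi, test_sqint mO tphi').
  have sgr (f : 'rV[R]_n -> R) : test f -> sqm (grad f).
    move=> tf i j; under eq_fun do rewrite mxE.
    by apply: test_sqint => //; exact: test_partial.
  exists (fun x => phi x - phi' x); split; first exact: testB.
    rewrite (_ : (fun x => _) =
        (fun x => (u x - phi x) + - (u' x - phi' x))); last first.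
      by apply/funext => x; ring.
    rewrite LpNorm2_scalarE //; last first.
      by apply: sqintB => //; exact: sqintB.
    under eq_fun do rewrite raddfB /=.
    move: d1 d1'; rewrite !LpNorm2_scalarE //; try exact: sqintB.
    rewrite !lte_fin => d1 d1'; rewrite (splitr e).
    apply: le_lt_trans (ltrD d1 d1').
    by apply: normL2B => //; apply: sqintmx_scalar => //; exact: sqintB.
  have s1 := sqintmxB mO sg (sgr _ tphi); have s2 := sqintmxB mO sg' (sgr _ tphi').
  have sub : (fun x => frob (g x - g' x - grad (fun x => phi x - phi' x) x)) =
      frob \o (fun x => (g x - grad phi x) - (g' x - grad phi' x)).
    apply/funext => x /=; congr frob; apply/rowP => j; rewrite !mxE.
    rewrite {1}/partial (_ : 'D_('e_j) _ x = partial j phi x - partial j phi' x).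
      by ring.
    by apply: deriveB; apply: smooth_derivable; [case: tphi|case: tphi'].
  rewrite sub (LpNorm2_fieldE mO (sqintmxB mO s1 s2)) lte_fin.
  have -> : e = e / 2 + e / 2 by rewrite -splitr.
  apply: le_lt_trans (normL2B mO s1 s2) _; apply: ltrD.
    by move: d2; rewrite -[fun x => frob _]/(frob \o _) (LpNorm2_fieldE mO s1) lte_fin.
  by move: d2'; rewrite -[fun x => frob _]/(frob \o _) (LpNorm2_fieldE mO s2) lte_fin.
Qed.

End sobolev_spaces.

Section trilinear.
Context {R : realType} {n : nat} (Omega : set 'rV[R]_n).
Hypothesis mO : measurable Omega.
Local Notation leb := (lebesgue_rV n).
Local Notation sqi := (sqint leb Omega).
Local Notation sqm := (sqintmx leb Omega).
Local Notation norm := (normL2 leb Omega).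
Local Notation dot := (dotL2 leb Omega).
Local Notation test := (test_function Omega).
Implicit Types (u v w : 'rV[R]_n -> 'rV[R]_n) (G H : 'rV[R]_n -> 'M[R]_n).

Lemma spaceV_sqintmx v G : spaceV Omega v G -> sqm v /\ sqm G.
Proof.
move=> vV; split=> i j.
  by have [/(L2P mO) + _ _ _] := vV j; rewrite (ord1 i).
have [_ /(L2fieldP mO)/(_ 0 j) + _ _] := vV i.
by under eq_fun do rewrite mxE.
Qed.

Lemma spaceVB v G w H : spaceV Omega v G -> spaceV Omega w H ->
  spaceV Omega (fun x => v x - w x) (fun x => G x - H x).
Proof.
move=> vV wV i; have := H10B mO (vV i) (wV i).
rewrite (_ : (fun x => (v x - w x) 0 i) = fun x => v x 0 i - w x 0 i); last first.
  by apply/funext => x; rewrite !mxE.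
rewrite (_ : (fun x => row i (G x - H x)) = fun x => row i (G x) - row i (H x)) //.
by apply/funext => x; rewrite raddfB.
Qed.

Definition vfield (Phi : 'I_n -> 'rV[R]_n -> R) x : 'rV[R]_n := \row_i Phi i x.

Definition jacobian (Phi : 'I_n -> 'rV[R]_n -> R) x : 'M[R]_n :=
  \matrix_(i, j) partial j (Phi i) x.

Lemma spaceV_test Phi : (forall i, test (Phi i)) ->
  spaceV Omega (vfield Phi) (jacobian Phi).
Proof.
move=> tPhi i; have := H10_test mO (tPhi i).
rewrite (_ : (fun x => vfield Phi x 0 i) = Phi i); last first.
  by apply/funext => x; rewrite mxE.
rewrite (_ : (fun x => row i (jacobian Phi x)) = grad (Phi i)) //.
by apply/funext => x; apply/rowP => j; rewrite !mxE.
Qed.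

(** Lets the scalar definition of H^1_0, and the scalar Poincare inequality, be
    applied component by component. *)
Lemma sqr_normL2_rows m k (A : 'rV[R]_n -> 'M[R]_(m, k)) : sqm A ->
  norm A ^+ 2 = \sum_i norm (fun x => row i (A x)) ^+ 2.
Proof.
move=> sA.
have srow i : sqm (fun x => row i (A x)).
  by move=> j l; under eq_fun do rewrite mxE; exact: sA.
under eq_bigr do rewrite sqr_normL2.
rewrite sqr_normL2 /dotL2 -Rintegral_sum //; last first.
  by move=> i; exact: integrable_mxdot.
apply: eq_Rintegral => x _; rewrite /mxdot; apply: eq_bigr => i _.
by rewrite big_ord1; apply: eq_bigr => j _; rewrite !mxE.
Qed.

(** Only the convergence of the gradients is recorded: the convergence of the
    fields themselves in L4 follows from it by the Sobolev inequality. *)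
Lemma spaceV_dense v G (e : R) : spaceV Omega v G -> 0 < e ->
  exists Phi, (forall i, test (Phi i)) /\ norm (fun x => G x - jacobian Phi x) < e.
Proof.
move=> vV e0; pose e' := e / n.+1%:R.
have e'0 : 0 < e' by rewrite divr_gt0.
have /choice[Phi PhiP] (i : 'I_n) : exists phi, test phi /\
    (LpNorm Omega 2 (fun x => frob (row i (G x) - grad phi x)) < e'%:E)%E.
  by have [_ _ _ /(_ _ e'0)[phi [? _ ?]]] := vV i; exists phi.
exists Phi; split => [i|]; first by case: (PhiP i).
have tPhi i : test (Phi i) by case: (PhiP i).
have [_ sG] := spaceV_sqintmx vV.
have [_ sP] := spaceV_sqintmx (spaceV_test tPhi).
have sA := sqintmxB mO sG sP.
rewrite -ltr_sqr ?nnegrE ?normL2_ge0 ?(ltW e0) // sqr_normL2_rows //.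
apply: (@le_lt_trans _ _ (\sum_(i < n) e' ^+ 2)).
  apply: ler_sum => i _; rewrite ler_sqr ?nnegrE ?normL2_ge0 ?(ltW e'0) //.
  have [_ lt_e] := PhiP i; rewrite -lee_fin; apply: le_trans (ltW lt_e).
  have si : sqm (fun x => row i (G x - jacobian Phi x)).
    by move=> j l; under eq_fun do rewrite mxE; exact: sA.
  rewrite -(LpNorm2_fieldE mO si).
  rewrite (_ : _ \o _ = (fun x => frob (row i (G x) - grad (Phi i) x))) //.
  apply/funext => x /=; congr frob; rewrite raddfB; congr (_ - _).
  by apply/rowP => j; rewrite !mxE.
rewrite sumr_const card_ord -mulr_natl /e' expr_div_n mulrCA.
rewrite -[ltRHS]mulr1 ltr_pM2l ?exprn_gt0 // ltr_pdivrMr ?exprn_gt0 // mul1r.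
by rewrite -natrX ltr_nat -mulnn leq_pmulr.
Qed.

(** Since Phi_i d_j Phi_i = d_j (Phi_i^2) / 2, testing the weak gradient of u
    with Phi_i^2 and summing over j leaves the divergence of u. *)
Lemma convection_test_eq0 u G Phi : spaceVdiv Omega u G ->
  (forall i, test (Phi i)) ->
  dot (jacobian Phi) (fun x => (vfield Phi x)^T *m u x) = 0.
Proof.
move=> [uV divu] tPhi; have [su sG] := spaceV_sqintmx uV.
have tpp i j : test (fun x => partial j (Phi i) x * Phi i x).
  by apply: testM; [exact: test_partial|case: (tPhi i)].
have tsq i : test (fun x => Phi i x * Phi i x).
  by apply: testM => //; case: (tPhi i).
have Ij i j : leb.-integrable Omega
    (EFin \o (fun x => u x 0 j * (partial j (Phi i) x * Phi i x))).
  by apply: sqint_mul => //; exact: test_sqint.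
have -> : dot (jacobian Phi) (fun x => (vfield Phi x)^T *m u x) =
   \sum_i \sum_j \int[leb]_(x in Omega) (u x 0 j * (partial j (Phi i) x * Phi i x)).
  under eq_bigr do rewrite -Rintegral_sum //.
  rewrite -Rintegral_sum // => [|i]; last first.
    have : leb.-integrable Omega (fun x => \sum_(j < n)
        (u x 0 j * (partial j (Phi i) x * Phi i x))%:E)%E.
      by apply: integrable_sum => // j _; exact: Ij.
    by apply: eq_integrable => // x _ /=; rewrite sumEFin.
  apply: eq_Rintegral => x _; apply: eq_bigr => i _; apply: eq_bigr => j _.
  by rewrite !mxE big_ord1 !mxE; ring.
apply: big1 => i _.
have halfE j : \int[leb]_(x in Omega) (u x 0 j * (partial j (Phi i) x * Phi i x)) =
   - 2^-1 * \int[leb]_(x in Omega) (G x j j * (Phi i x * Phi i x)).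
  have [_ _ /(_ _ (tsq i) j) + _] := uV j.
  rewrite partialM; try by move=> x; apply: smooth_derivable; case: (tPhi i).
  rewrite (_ : Rintegral _ _ _ = 2 * \int[leb]_(x in Omega)
      (u x 0 j * (partial j (Phi i) x * Phi i x))); last first.
    by rewrite -RintegralZl //; apply: eq_Rintegral => x _; ring.
  under [in RHS]eq_Rintegral do rewrite mxE.
  by move=> H2; lra.
rewrite (eq_bigr _ (fun j _ => halfE j)) -mulr_sumr -Rintegral_sum //; last first.
  by move=> j; apply: sqint_mul => //; exact: test_sqint.
rewrite (_ : Rintegral _ _ _ = 0) ?mulr0 //.
transitivity (\int[leb]_(x in Omega) (0 : R)); last by rewrite Rintegral_cst // mul0r.
apply: ae_eq_Rintegral => //.
- have : leb.-integrable Omega (fun x => \sum_(j < n)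
      (G x j j * (Phi i x * Phi i x))%:E)%E.
    apply: integrable_sum => // j _.
    by apply: sqint_mul => //; exact: test_sqint.
  by apply: eq_integrable => // x _ /=; rewrite sumEFin.
- exact: integrable0.
- apply: filterS divu => x divu Ox; rewrite -mulr_suml.
  by rewrite -[X in X * _]/(\tr (G x)) divu // mul0r.
Qed.

Section sobolev_embedding.
Variable CS : R.
Hypothesis hCS : Sobolev_const Omega CS.

Lemma spaceV_L4 v G : spaceV Omega v G ->
  L4field leb Omega v /\ int4 leb Omega v <= (CS * norm G) ^+ 4.
Proof.
move=> vV; have [CS0 /(_ _ _ vV) H] := hCS; have [sv sG] := spaceV_sqintmx vV.
apply: LpNorm4_le => //.
- by rewrite mulr_ge0 ?normL2_ge0 // ltW.
- by move=> i j; case: (sv i j).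
- by rewrite EFinM -LpNorm2_fieldE.
Qed.

Lemma sqintmx_spaceV_outer v G w H : spaceV Omega v G -> spaceV Omega w H ->
  sqm (fun x => (v x)^T *m w x).
Proof. by move=> /spaceV_L4[? _] /spaceV_L4[? _]; exact: sqintmx_outer. Qed.

(** The convection form is continuous on V: apply the Sobolev inequality to
    both velocities in v (x) w. *)
Lemma convection_le v G w H A : spaceV Omega v G -> spaceV Omega w H -> sqm A ->
  `|dot A (fun x => (v x)^T *m w x)| <= norm A * (CS ^+ 2 * norm G * norm H).
Proof.
move=> vV wV sA; have so := sqintmx_spaceV_outer vV wV.
have [Lv iv] := spaceV_L4 vV; have [Lw iw] := spaceV_L4 wV.
have CS0 : 0 <= CS by case: hCS => /ltW.
apply: le_trans (dotL2_le mO sA so) _; apply: ler_wpM2l; first exact: normL2_ge0.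
rewrite -(@ler_pXn2r _ 4) ?nnegrE ?normL2_ge0 //; last first.
  by rewrite !mulr_ge0 ?exprn_ge0 ?normL2_ge0.
apply: le_trans (normL2_outer mO Lv Lw) _.
rewrite (_ : _ ^+ 4 = (CS * norm G) ^+ 4 * (CS * norm H) ^+ 4); last by ring.
by apply: ler_pM => //; apply: Rintegral_ge0 => x _; rewrite exprn_ge0 ?frob_ge0.
Qed.

(** Skew symmetry of the convection form of a solenoidal field, by density: with
    Phi close to w, the form at w differs from the form at Phi, which is zero,
    by a multiple of the distance of the gradients. *)
Lemma convection_eq0 u G w H : spaceVdiv Omega u G -> spaceV Omega w H ->
  dot H (fun x => (w x)^T *m u x) = 0.
Proof.
move=> udiv wV; have [uV _] := udiv; have [_ sH] := spaceV_sqintmx wV.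
set b := dot H _.
set K := CS ^+ 2 * norm G.
have K0 : 0 <= K by rewrite mulr_ge0 ?sqr_ge0 ?normL2_ge0.
(* |b(w)| <= e K (|H| + |grad Phi|), and |grad Phi| <= |H| + e. *)
have Hb (e : R) : 0 < e -> e <= 1 -> `|b| <= e * (K * (2 * norm H + 1)).
  move=> e0 e1; have [Phi [tPhi ePhi]] := spaceV_dense wV e0.
  have PV := spaceV_test tPhi; have [_ sP] := spaceV_sqintmx PV.
  have wPV := spaceVB wV PV; have sHP := sqintmxB mO sH sP.
  set d := norm (fun x => H x - jacobian Phi x) in ePhi.
  have d0 : 0 <= d by exact: normL2_ge0.
  have sw := sqintmx_spaceV_outer wV uV.
  have sPu := sqintmx_spaceV_outer PV uV.
  have bE : b = dot (fun x => H x - jacobian Phi x) (fun x => (w x)^T *m u x) +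
      dot (jacobian Phi) (fun x => (w x - vfield Phi x)^T *m u x).
    rewrite dotL2Bl // [X in _ + X](_ : _ =
        dot (jacobian Phi) (fun x => (w x)^T *m u x)).
      by rewrite /b; ring.
    rewrite -[RHS]subr0 -(convection_test_eq0 udiv tPhi) -dotL2Br //.
    by apply: eq_Rintegral => x _; rewrite raddfB mulmxBl.
  have b1 := convection_le wV uV sHP.
  have b2 := convection_le wPV uV sP.
  have nP : norm (jacobian Phi) <= norm H + d.
    have := normL2B mO sH sHP; rewrite -/d; congr (normL2 _ _ _ <= _).
    by apply/funext => x; rewrite opprB addrC subrK.
  rewrite -/d in b1 b2.
  rewrite bE; apply: le_trans (ler_normD _ _) _.
  apply: le_trans (lerD b1 b2) _.
  rewrite (_ : d * _ + _ = K * (d * (norm H + norm (jacobian Phi)))); last first.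
    by rewrite /K; ring.
  rewrite [leRHS]mulrCA; apply: ler_wpM2l => //.
  have h0 : 0 <= norm H by exact: normL2_ge0.
  apply: (@le_trans _ _ (d * (2 * norm H + 1))).
    by apply: ler_wpM2l => //; lra.
  by apply: ler_wpM2r; lra.
apply/eqP; rewrite -normr_eq0; apply/eqP.
set C := K * _ in Hb; have C0 : 0 <= C.
  by rewrite mulr_ge0 // addr_ge0 // mulr_ge0 // normL2_ge0.
have := normr_ge0 b; rewrite le_eqVlt => /predU1P[<- //|b0].
(* This choice of e gives e C < |b|, contradicting [Hb]. *)
have D0 : 0 < `|b| + C + 1 by lra.
have e0 : 0 < `|b| / (`|b| + C + 1) by rewrite divr_gt0.
have e1 : `|b| / (`|b| + C + 1) <= 1 by rewrite ler_pdivrMr // mul1r; lra.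
by have := Hb _ e0 e1; rewrite mulrAC ler_pdivlMr // ler_pM2l //; lra.
Qed.

End sobolev_embedding.
End trilinear.

(** * The constitutive law *)

Section flux.
Context {R : realType} (mu : R -> R).
Hypothesis hmu_C0 : {within `[0, +oo[, continuous mu}.

(** At 0 only continuity is available, which suffices for the mean value
    theorem on [0, +oo[. *)
Lemma mulid_nondecreasing :
  (forall a, 0 < a -> derivable mu a 1) ->
  (forall a, 0 < a -> 0 < derive1 (fun b => mu b * b) a) ->
  forall a b, 0 <= a -> a <= b -> mu a * a <= mu b * b.
Proof.
move=> dmu dmu0; apply: (@ger0_derive1_ndecry _ (fun b => mu b * b)) => [x|x|].
- rewrite in_itv /= andbT => x0; apply: derivableM; first exact: dmu.
  exact: derivable_id.
- by rewrite in_itv /= andbT => /dmu0 /ltW.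
- move=> x; apply: cvgM; first exact: hmu_C0.
  have cid : {within `[0, +oo[, continuous (fun b : R => b)}.
    by apply: continuous_subspaceT => y.
  exact: cid.
Qed.

Definition flux m n (T : 'M[R]_(m, n)) : 'M[R]_(m, n) := mu (frob T) *: T.

(** By Cauchy-Schwarz T : S <= |T| |S|, the expression is at least
    (mu(|T|) |T| - mu(|S|) |S|) (|T| - |S|). *)
Lemma flux_monotone m n (T S : 'M[R]_(m, n)) :
  (forall a, 0 <= a -> 0 < mu a) ->
  (forall a b, 0 <= a -> a <= b -> mu a * a <= mu b * b) ->
  0 <= mxdot (flux T - flux S) (T - S).
Proof.
move=> mu0 mu_mono; rewrite mxdotBl !mxdotBr /flux !mxdotZl (mxdotC S T) -!sqr_frob.
have := ler_norm (mxdot T S); have := mxdot_le_frob T S.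
have := mu0 _ (frob_ge0 T); have := mu0 _ (frob_ge0 S).
have := frob_ge0 T; have := frob_ge0 S.
set a := frob T; set b := frob S; set c := mxdot T S => b0 a0 mb ma c1 c2.
have cab : c <= a * b by exact: le_trans c1.
have : 0 <= (mu a * a - mu b * b) * (a - b).
  have [ab|ba] := leP a b.
    by have := mu_mono _ _ a0 ab => H; rewrite -mulrNN; apply: mulr_ge0; lra.
  by have := mu_mono _ _ b0 (ltW ba) => H; apply: mulr_ge0; lra.
have : (mu a + mu b) * c <= (mu a + mu b) * (a * b) by apply: ler_wpM2l => //; lra.
lra.
Qed.

Lemma frob_flux_le m n (C : R) (T : 'M[R]_(m, n)) :
  (forall a, 0 <= a -> 0 < mu a) -> (forall a, 0 <= a -> mu a * a <= C) ->
  frob (flux T) <= C.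
Proof.
move=> mu0 muC; rewrite frobZ; first by apply: muC; exact: frob_ge0.
by apply/ltW/mu0; exact: frob_ge0.
Qed.

(** mu is only continuous, hence measurable, on [0, +oo[; Frobenius norms take
    their values there. *)
Lemma measurable_flux d (X : measurableType d) (D : set X) m n
    (T : X -> 'M[R]_(m, n)) : measurable D ->
  (forall i j, measurable_fun D (fun x => T x i j)) ->
  forall i j, measurable_fun D (fun x => flux (T x) i j).
Proof.
move=> mD mT i j; under eq_fun do rewrite mxE.
apply: measurable_funM => //.
have mT0 := measurable_frob mT.
have mmu : measurable_fun (`[0, +oo[%classic : set R) mu.
  by apply: subspace_continuous_measurable_fun.
apply: (measurable_comp _ _ mmu mT0) => //.
by move=> _ [x _ <-]; rewrite /= in_itv /= andbT frob_ge0.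
Qed.

End flux.

(** * Energy estimates *)

Section energy.
Context {R : realType} {n : nat} (Omega : set 'rV[R]_n).
Hypothesis mO : measurable Omega.
Local Notation leb := (lebesgue_rV n).
Local Notation sqi := (sqint leb Omega).
Local Notation sqm := (sqintmx leb Omega).
Local Notation norm := (normL2 leb Omega).
Local Notation dot := (dotL2 leb Omega).
Implicit Types (u v w : 'rV[R]_n -> 'rV[R]_n) (G H : 'rV[R]_n -> 'M[R]_n).

Definition strain G x := symgrad (G x).

Lemma sqintmx_strain G : sqm G -> sqm (strain G).
Proof.
move=> sG i j; under eq_fun do rewrite !mxE.
by apply: sqintZ => //; exact: sqintD.
Qed.

Lemma strainB G H : strain (fun x => G x - H x) = (fun x => strain G x - strain H x).
Proof.
by apply/funext => x; rewrite /strain /symgrad raddfB /= -scalerBr opprD addrACA.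
Qed.

Lemma spaceVdivB v G w H : spaceVdiv Omega v G -> spaceVdiv Omega w H ->
  spaceVdiv Omega (fun x => v x - w x) (fun x => G x - H x).
Proof.
move=> [vV dv] [wV dw]; split; first exact: spaceVB.
apply: filterS2 dv dw => x dv dw Ox.
by rewrite raddfB /= dv // dw // subrr.
Qed.

Lemma spaceMB S T : spaceM Omega S -> spaceM Omega T ->
  spaceM Omega (fun x => S x - T x).
Proof.
move=> [/(L2fieldP mO) sS mS] [/(L2fieldP mO) sT mT]; split.
  by apply/L2fieldP => //; exact: sqintmxB.
apply: filterS2 mS mT => x mS mT Ox.
have [Sx trS] := mS Ox; have [Tx trT] := mT Ox.
by rewrite raddfB /= Sx Tx raddfB /= trS trT subrr.
Qed.

Lemma Poincare_field CP v G : Poincare_const Omega CP -> spaceV Omega v G ->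
  norm v <= CP * norm G.
Proof.
move=> [CP0 hCP] vV; have [sv sG] := spaceV_sqintmx mO vV.
rewrite -ler_sqr ?nnegrE ?normL2_ge0 ?mulr_ge0 ?normL2_ge0 ?(ltW CP0) //.
rewrite exprMn (sqr_normL2_rows mO sG) mulr_sumr sqr_normL2.
have -> : dot v v = \sum_i \int[leb]_(x in Omega) (v x 0 i ^+ 2).
  rewrite -Rintegral_sum => [|//|i]; last by case: (sv 0 i).
  by apply: eq_Rintegral => x _; rewrite /mxdot big_ord1.
apply: ler_sum => i _; have := hCP _ _ (vV i).
have srow : sqm (fun x => row i (G x)).
  by move=> j l; under eq_fun do rewrite mxE; exact: sG.
rewrite (LpNorm2E mO (sv 0 i)) (LpNorm2_fieldE mO srow) -EFinM lee_fin => H.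
rewrite -exprMn -[leLHS]sqr_sqrtr; last first.
  by apply: Rintegral_ge0 => x _; exact: sqr_ge0.
by rewrite ler_sqr ?nnegrE ?sqrtr_ge0 // mulr_ge0 ?normL2_ge0 // ltW.
Qed.

Lemma Korn_field CK v G : Korn_const Omega CK -> spaceV Omega v G ->
  norm G <= CK * norm (strain G).
Proof.
move=> [CK0 hCK] vV; have [sv sG] := spaceV_sqintmx mO vV.
have := hCK _ _ vV.
by rewrite (LpNorm2_fieldE mO sG) (LpNorm2_fieldE mO (sqintmx_strain sG)) -EFinM lee_fin.
Qed.

Lemma integral_convection u G v :
  \int[leb]_(x in Omega) mxdot (convection (u x) (G x)) (v x) =
  dot G (fun x => (v x)^T *m u x).
Proof. by apply: eq_Rintegral => x _; rewrite mxdot_convection. Qed.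

End energy.

Section norm_estimates.
Context d (X : measurableType d) (R : realType).
Variables (mu : {measure set X -> \bar R}) (D : set X).
Hypothesis mD : measurable D.

Lemma normL2_le_ae m n k l (c : R) (A : X -> 'M[R]_(m, n)) (B : X -> 'M[R]_(k, l)) :
  0 <= c -> sqintmx mu D A -> sqintmx mu D B ->
  {ae mu, forall x, D x -> frob (A x) <= c * frob (B x)} ->
  normL2 mu D A <= c * normL2 mu D B.
Proof.
move=> c0 sA sB AB.
rewrite -ler_sqr ?nnegrE ?mulr_ge0 ?normL2_ge0 // exprMn !sqr_normL2.
rewrite -RintegralZl //; last exact: integrable_mxdot.
apply: ae_le_Rintegral => //; first exact: integrable_mxdot.
  by apply: integrable_mulr => //; exact: integrable_mxdot.
apply: filterS AB => x AB Dx; rewrite -!sqr_frob -exprMn.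
by rewrite ler_sqr ?nnegrE ?mulr_ge0 ?frob_ge0 //; exact: AB.
Qed.

Lemma sqintmx_bounded m n (C : R) (A : X -> 'M[R]_(m, n)) : (mu D < +oo)%E ->
  (forall i j, measurable_fun D (fun x => A x i j)) ->
  (forall x, D x -> frob (A x) <= C) -> sqintmx mu D A.
Proof.
move=> muD mA AC i j; apply: (sqint_bounded mD muD (C := C)) => // x Dx.
exact: le_trans (entry_le_frob _ _ _) (AC _ Dx).
Qed.

Lemma normL2_bounded m n (C : R) (A : X -> 'M[R]_(m, n)) : (mu D < +oo)%E ->
  0 <= C -> sqintmx mu D A ->
  (forall x, D x -> frob (A x) <= C) ->
  normL2 mu D A <= C * Num.sqrt (fine (mu D)).
Proof.
move=> muD C0 sA AC.
rewrite -ler_sqr ?nnegrE ?mulr_ge0 ?normL2_ge0 ?sqrtr_ge0 // exprMn sqr_normL2.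
rewrite sqr_sqrtr ?fine_ge0 // -Rintegral_cst //.
apply: le_Rintegral => //; first exact: integrable_mxdot.
  have cC x : D x -> `|cst C x| <= C by move=> _; rewrite /= ger0_norm.
  by have [] := sqint_bounded mD muD (measurable_cst C) cC.
move=> x Dx; rewrite -sqr_frob ler_sqr ?nnegrE ?frob_ge0 //; exact: AC.
Qed.

End norm_estimates.

Section solutions.
Context {R : realType} {n : nat} (Omega : set 'rV[R]_n).
Hypothesis mO : measurable Omega.
Local Notation leb := (lebesgue_rV n).
Local Notation sqm := (sqintmx leb Omega).
Local Notation norm := (normL2 leb Omega).
Local Notation dot := (dotL2 leb Omega).
Variables (CP CK CS : R).
Hypothesis hCP : Poincare_const Omega CP.
Hypothesis hCK : Korn_const Omega CK.
Hypothesis hCS : Sobolev_const Omega CS.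

(** The hypothesis is the momentum balance tested with the solution itself, N
    standing for the flux of the stress.  The convection term vanishes, and
    |D(u)|^2 is bounded by a multiple of |D(u)|. *)
Lemma strain_apriori_le (alpha gamma : R) (u f : 'rV[R]_n -> 'rV[R]_n)
    (G N : 'rV[R]_n -> 'M[R]_n) :
  0 < alpha -> 0 < gamma -> spaceVdiv Omega u G -> sqm f -> sqm N ->
  dot G (fun x => (u x)^T *m u x) + alpha^-1 * dot (strain G) (strain G) =
    dot f u + gamma / alpha * dot N (strain G) ->
  norm (strain G) <= alpha * CP * CK * norm f + gamma * norm N.
Proof.
move=> a0 g0 udiv sf sN; have [uV _] := udiv.
have [su sG] := spaceV_sqintmx mO uV; have sD := sqintmx_strain mO sG.
rewrite (convection_eq0 mO hCS udiv uV) add0r -sqr_normL2 => E.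
have := Poincare_field mO hCP uV; have := Korn_field mO hCK uV.
have CP0 : 0 < CP by case: hCP.
have := le_trans (ler_norm _) (dotL2_le mO sf su).
have := le_trans (ler_norm _) (dotL2_le mO sN sD).
have := normL2_ge0 leb Omega f.
have := normL2_ge0 leb Omega N.
have := normL2_ge0 leb Omega (strain G).
move: E; set q := dot f u; set r := dot N _; set x := norm (strain G).
set nN := norm N; set nf := norm f; set nu := norm u; set nG := norm G.
move=> E x0 N0 f0 hr hq hG hu.
have H1 : nf * nu <= nf * (CP * (CK * x)).
  by apply: ler_wpM2l => //; apply: le_trans hu _; apply: ler_wpM2l => //; exact: ltW.
have {}E : x ^+ 2 = alpha * q + gamma * r.
  have -> : x ^+ 2 = alpha * (alpha^-1 * x ^+ 2) by field; rewrite gt_eqF.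
  by rewrite E; field; rewrite gt_eqF.
have H2 : alpha * q <= alpha * (nf * (CP * (CK * x))).
  by apply: ler_wpM2l; [exact: ltW|exact: le_trans hq H1].
have H3 : gamma * r <= gamma * (nN * x) by apply: ler_wpM2l => //; exact: ltW.
have H4 : x * x <= x * (alpha * CP * CK * nf + gamma * nN) by rewrite -expr2 E; lra.
move: x0; rewrite le_eqVlt => /predU1P[<-|x0]; last by rewrite ler_pM2l in H4.
have CK0 : 0 < CK by case: hCK.
by rewrite addr_ge0 // !mulr_ge0 // ltW.
Qed.

(** Split (u1 . grad) u1 - (u2 . grad) u2 as (w . grad) u1 + (u2 . grad) w; the
    second summand is orthogonal to w by skew symmetry. *)
Lemma convection_diff (u1 u2 : 'rV[R]_n -> 'rV[R]_n) (G1 G2 : 'rV[R]_n -> 'M[R]_n) :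
  let w x := u1 x - u2 x in
  spaceVdiv Omega u1 G1 -> spaceVdiv Omega u2 G2 ->
  dot G1 (fun x => (w x)^T *m u1 x) - dot G2 (fun x => (w x)^T *m u2 x) =
  dot G1 (fun x => (w x)^T *m w x).
Proof.
move=> w u1div u2div; have [[u1V _] [u2V _]] := (u1div, u2div).
have wV := spaceVB mO u1V u2V.
have [_ sG1] := spaceV_sqintmx mO u1V; have [_ sG2] := spaceV_sqintmx mO u2V.
have o1 := sqintmx_spaceV_outer mO hCS wV u1V.
have o2 := sqintmx_spaceV_outer mO hCS wV u2V.
have := convection_eq0 mO hCS u2div wV; rewrite dotL2Bl // => E.
have -> : (fun x => (w x)^T *m w x) = (fun x => (w x)^T *m u1 x - (w x)^T *m u2 x).
  by apply/funext => x; rewrite -mulmxBr.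
by rewrite dotL2Br //; lra.
Qed.

End solutions.

(** The real-number core of the uniqueness proof.  Here x, e, nG, nG1 and nN are
    the norms of D(w), E, grad w, grad u1 and N; c is the convection term,
    p = (N, E), q = (N, D(w)), r = (D(w), E), and B bounds the norm of D(u1).  The
    outcome is x^2 <= theta x^2 with theta < 1. *)
Lemma energy_contraction (R : realFieldType)
    (alpha gamma Lambda CS CK B x e nN nG nG1 c p q r : R) :
  0 < alpha -> 0 < gamma -> 0 < Lambda -> 0 < CS -> 0 < CK ->
  0 <= x -> 0 <= e -> 0 <= nG -> 0 <= nG1 ->
  gamma / alpha * Lambda + alpha * CS ^+ 2 * CK ^+ 3 * B < 1 ->
  nG <= CK * x -> nG1 <= CK * B ->
  alpha * e ^+ 2 + gamma * p = r -> 0 <= p -> r <= x * e ->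
  c + alpha^-1 * x ^+ 2 = gamma / alpha * q ->
  q <= nN * x -> nN <= Lambda * e ->
  `|c| <= nG1 * (CS ^+ 2 * nG * nG) ->
  x = 0 /\ e = 0.
Proof.
move=> a0 g0 L0 S0 K0 x0 e0 nG0 nG10 small hG hG1 law p0 hr mom hq hN hc.
have ae : alpha * e <= x.
  have H : (alpha * e) * e <= x * e.
    rewrite -mulrA -expr2; apply: le_trans hr; rewrite -law lerDl.
    by rewrite mulr_ge0 // ltW.
  move: e0; rewrite le_eqVlt => /predU1P[<-|e0]; first by rewrite mulr0.
  by rewrite ler_pM2r in H.
suff x00 : x = 0.
  split => //; apply/eqP; rewrite eq_le e0 andbT.
  by rewrite x00 pmulr_rle0 in ae.
have qle : gamma * q <= gamma / alpha * Lambda * x ^+ 2.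
  rewrite -!mulrA; apply: ler_wpM2l; first exact: ltW.
  apply: le_trans hq _; apply: (@le_trans _ _ (Lambda * e * x)).
    exact: ler_wpM2r.
  have -> : Lambda * e * x = alpha^-1 * (Lambda * (alpha * e * x)).
    by field; rewrite gt_eqF.
  apply: ler_wpM2l; first by rewrite invr_ge0 ltW.
  apply: ler_wpM2l; first exact: ltW.
  by rewrite expr2; exact: ler_wpM2r.
have cle : - (alpha * c) <= alpha * CS ^+ 2 * CK ^+ 3 * B * x ^+ 2.
  rewrite -mulrN.
  have -> : alpha * CS ^+ 2 * CK ^+ 3 * B * x ^+ 2 =
      alpha * ((CK * B) * (CS ^+ 2 * ((CK * x) * (CK * x)))) by ring.
  apply: ler_wpM2l; first exact: ltW.
  apply: le_trans (ler_norm _) _; rewrite normrN; apply: le_trans hc _.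
  rewrite -mulrA; apply: ler_pM => //; first by rewrite mulr_ge0 ?sqr_ge0 ?mulr_ge0.
  by apply: ler_wpM2l; [exact: sqr_ge0|exact: ler_pM].
have E : x ^+ 2 = gamma * q - alpha * c.
  have -> : x ^+ 2 = alpha * (c + alpha^-1 * x ^+ 2) - alpha * c.
    by field; rewrite gt_eqF.
  by rewrite mom; field; rewrite gt_eqF.
have H : x ^+ 2 * (1 - (gamma / alpha * Lambda + alpha * CS ^+ 2 * CK ^+ 3 * B)) <= 0.
  by rewrite mulrBr mulr1 [X in X - _]E; lra.
move: H; rewrite pmulr_lle0 ?subr_gt0 // => H.
by apply/eqP; rewrite -sqrf_eq0 eq_le H sqr_ge0.
Qed.

(** * Uniqueness *)

Local Notation nrm := (normL2 (lebesgue_rV _)).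
Local Notation dot := (dotL2 (lebesgue_rV _)).

Theorem proposition2 (R : realType) (d : nat) (hd : d = 2%N \/ d = 3%N)
    (Omega : set 'rV[R]_d)
    (hopen : open Omega) (hbounded : bounded_set Omega)
    (hsc : simply_connected Omega) (hlip : lipschitz_boundary Omega)
    (f : 'rV[R]_d -> 'rV[R]_d) (hf : L2field Omega f)
    (alpha gamma : R) (halpha : 0 < alpha) (hgamma : 0 < gamma)
    (mu : R -> R) (C1 : R)
    (hmu_C0 : {within `[0, +oo[, continuous mu})
    (hmu_C1 : forall a, 0 < a -> derivable mu a 1 /\ {for a, continuous (derive1 mu)})
    (hmu_mono : forall a, 0 < a -> 0 < derive1 (fun b => mu b * b) a)
    (hmu_pos : forall a, 0 <= a -> 0 < mu a)
    (hC1 : 0 < C1) (hmu_C1bound : forall a, 0 <= a -> mu a * a <= C1)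
    (CP CK CS : R)
    (hCP : Poincare_const Omega CP) (hCK : Korn_const Omega CK)
    (hCS : Sobolev_const Omega CS)
    (hCS_min : forall C, Sobolev_const Omega C -> CS <= C)
    (Lambda : R) (hLambda : 0 < Lambda)
    (hLip : forall T S : 'M[R]_d,
      T^T = T -> \tr T = 0 -> S^T = S -> \tr S = 0 ->
      frob (mu (frob T) *: T - mu (frob S) *: S) <= Lambda * frob (T - S))
    (hsmall : ((gamma / alpha * Lambda)%:E
      + (alpha ^+ 2 * CS ^+ 2 * CP * CK ^+ 4)%:E * LpNorm Omega 2 (frob \o f)
      + (alpha * gamma * CS ^+ 2 * CK ^+ 3 * C1)%:E
          * lebesgue_rV d Omega `^ 2^-1 < 1)%E)
    (T1 T2 : 'rV[R]_d -> 'M[R]_d) (u1 u2 : 'rV[R]_d -> 'rV[R]_d)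
    (hsol1 : is_solution Omega alpha gamma mu f T1 u1)
    (hsol2 : is_solution Omega alpha gamma mu f T2 u2) :
  {ae lebesgue_rV d, forall x, Omega x -> T1 x = T2 x /\ u1 x = u2 x}.
Proof.
have mO := open_measurable_rV hopen.
have [[[CP0 _] [CK0 _]] [CS0 _]] := (hCP, hCK, hCS).
have /(L2fieldP mO) sf := hf.
(* An infinite measure would make the left-hand side of [hsmall] infinite. *)
have Ofin : (lebesgue_rV d Omega < +oo)%E.
  rewrite ltey; apply/negP => /eqP Ooo; move: hsmall.
  rewrite Ooo poweRyr ?invr_eq0 ?pnatr_eq0 // gt0_muley ?lte_fin; last first.
    by rewrite !mulr_gt0 ?exprn_gt0.
  by rewrite (LpNorm2_fieldE mO sf) -EFinM -EFinD addey.
have {hsmall} small : gamma / alpha * Lambda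
    + alpha * CS ^+ 2 * CK ^+ 3 * (alpha * CP * CK * nrm Omega f
       + gamma * (C1 * Num.sqrt (fine (lebesgue_rV d Omega)))) < 1.
  move: hsmall; rewrite (LpNorm2_fieldE mO sf) -[lebesgue_rV d Omega]fineK ?ge0_fin_numE //.
  rewrite poweR_EFin powR12_sqrt ?fine_ge0 // -!EFinM -!EFinD lte_fin.
  by congr (_ < 1); ring.
have [MT1 [G1 u1div eq1]] := hsol1; have [MT2 [G2 u2div eq2]] := hsol2.
have [[/(L2fieldP mO) sT1 symT1] [/(L2fieldP mO) sT2 symT2]] := (MT1, MT2).
have [[u1V _] [u2V _]] := (u1div, u2div).
have mu_mono := mulid_nondecreasing hmu_C0 (fun a a0 => (hmu_C1 a a0).1) hmu_mono.
pose N1 x := flux mu (T1 x); pose N2 x := flux mu (T2 x).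
have fluxL2 (T : 'rV[R]_d -> 'M[R]_d) : sqintmx (lebesgue_rV d) Omega T ->
    sqintmx (lebesgue_rV d) Omega (fun x => flux mu (T x)).
  move=> sT; apply: (sqintmx_bounded mO Ofin (C := C1)) => [|x _].
    by apply: measurable_flux => // i j; case: (sT i j).
  exact: frob_flux_le.
have sN1 : sqintmx (lebesgue_rV d) Omega N1 by exact: fluxL2.
have sN2 : sqintmx (lebesgue_rV d) Omega N2 by exact: fluxL2.
have sN := sqintmxB mO sN1 sN2; have sE := sqintmxB mO sT1 sT2.
have ME := spaceMB mO MT1 MT2; have wdiv := spaceVdivB mO u1div u2div.
pose E x := T1 x - T2 x; pose w x := u1 x - u2 x; pose Gw x := G1 x - G2 x.
have [wV _] : spaceVdiv Omega w Gw := wdiv.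
have [sw sGw] := spaceV_sqintmx mO wV; have sDw := sqintmx_strain mO sGw.
have [_ sG1] := spaceV_sqintmx mO u1V; have sD1 := sqintmx_strain mO sG1.
have [_ sG2] := spaceV_sqintmx mO u2V; have sD2 := sqintmx_strain mO sG2.
have DwE : strain Gw = (fun x => strain G1 x - strain G2 x) by exact: strainB.
have boundD1 : nrm Omega (strain G1) <= alpha * CP * CK * nrm Omega f
       + gamma * (C1 * Num.sqrt (fine (lebesgue_rV d Omega))).
  have e1 : dot Omega G1 (fun x => (u1 x)^T *m u1 x)
      + alpha^-1 * dot Omega (strain G1) (strain G1)
      = dot Omega f u1 + gamma / alpha * dot Omega N1 (strain G1).
    by rewrite -integral_convection; exact: (eq1 _ _ _ MT1 u1div).1.
  have := strain_apriori_le mO hCP hCK hCS halpha hgamma u1div sf sN1 e1.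
  move=> /le_trans; apply; rewrite lerD2l; apply: ler_wpM2l; first exact: ltW.
  apply: normL2_bounded => // [|x _]; first exact: ltW.
  exact: frob_flux_le.
(* The source term cancels because both solutions are tested with the same w. *)
have momentum : dot Omega G1 (fun x => (w x)^T *m w x)
      + alpha^-1 * dot Omega (strain Gw) (strain Gw)
      = gamma / alpha * dot Omega (fun x => N1 x - N2 x) (strain Gw).
  have e1 : dot Omega G1 (fun x => (w x)^T *m u1 x)
      + alpha^-1 * dot Omega (strain G1) (strain Gw)
      = dot Omega f w + gamma / alpha * dot Omega N1 (strain Gw).
    by rewrite -integral_convection; exact: (eq1 _ _ _ ME wdiv).1.
  have e2 : dot Omega G2 (fun x => (w x)^T *m u2 x)
      + alpha^-1 * dot Omega (strain G2) (strain Gw)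
      = dot Omega f w + gamma / alpha * dot Omega N2 (strain Gw).
    by rewrite -integral_convection; exact: (eq2 _ _ _ ME wdiv).1.
  rewrite -(convection_diff mO hCS u1div u2div) {1}DwE !dotL2Bl //.
  by lra.
have law : alpha * dot Omega E E + gamma * dot Omega (fun x => N1 x - N2 x) E =
    dot Omega (strain Gw) E.
  have e1 : alpha * dot Omega T1 E + gamma * dot Omega N1 E = dot Omega (strain G1) E.
    exact: (eq1 _ _ _ ME wdiv).2.
  have e2 : alpha * dot Omega T2 E + gamma * dot Omega N2 E = dot Omega (strain G2) E.
    exact: (eq2 _ _ _ ME wdiv).2.
  by rewrite DwE !dotL2Bl // -!/(dot Omega _ _); lra.
have monotone : 0 <= dot Omega (fun x => N1 x - N2 x) E.
  by apply: Rintegral_ge0 => x _; exact: flux_monotone.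
have lipN : nrm Omega (fun x => N1 x - N2 x) <= Lambda * nrm Omega E.
  apply: normL2_le_ae => //; first exact: ltW.
  apply: filterS2 symT1 symT2 => x sym1 sym2 Ox.
  have [T1x tr1] := sym1 Ox; have [T2x tr2] := sym2 Ox.
  exact: hLip.
have Gw_le := Korn_field mO hCK wV.
have G1_le := le_trans (Korn_field mO hCK u1V) (ler_wpM2l (ltW CK0) boundD1).
rewrite -!sqr_normL2 in momentum law.
have [Dw0 E0] := energy_contraction halpha hgamma hLambda CS0 CK0
  (normL2_ge0 _ _ _) (normL2_ge0 _ _ _) (normL2_ge0 _ _ _) (normL2_ge0 _ _ _)
  small Gw_le G1_le law monotone (le_trans (ler_norm _) (dotL2_le mO sDw sE))
  momentum (le_trans (ler_norm _) (dotL2_le mO sN sDw)) lipN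
  (convection_le mO hCS wV wV sG1).
have w0 : nrm Omega w = 0.
  apply/eqP; rewrite eq_le normL2_ge0 andbT; apply: le_trans (Poincare_field mO hCP wV) _.
  by rewrite pmulr_rle0 //; apply: le_trans Gw_le _; rewrite Dw0 mulr0.
apply: filterS2 (normL2_eq0 mO sE E0) (normL2_eq0 mO sw w0) => x Ex wx Ox.
by split; apply/eqP; rewrite -subr_eq0; [rewrite Ex|rewrite -/(w x) wx].
Qed.
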